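(* Let $\kappa\in(0,1]$ and let $0<r<r^*(\kappa)$, where $r^*(\kappa)$ is the threshold defined in the context. Then there exist constants $C,c>0$, depending only on $\kappa$ and $r$, such that for all positive integers $m$ for which $p:=\kappa m$ and $S:=rm$ are integers, the following holds. If $F$ is a $p\times m$ random matrix whose entries are i.i.d. Gaussian with mean zero and variance $1/p$, then with probability at least $1-Ce^{-cm}$, $$\delta_S+\theta_{S,S}+\theta_{S,2S}<1 .$$ Moreover, this conclusion holds in particular for all $0<r\le3.6\cdot10^{-4}$ when $\kappa=p/m=3/4$, for all $0<r\le3.2\cdot10^{-4}$ when $\kappa=2/3$, and for all $0<r\le2.3\cdot10^{-4}$ when $\kappa=1/2$.
   Context: Threshold: let $H(q):=-q\log q-(1-q)\log(1-q)$ for $0<q<1$ (natural logarithm). For $\kappa\in(0,1]$ and $0<q<1$ let $f_\kappa(q):=\kappa^{-1/2}\left(\sqrt q+\sqrt{2H(q)}\right)$. For $0<r<1/3$ let $\rho_\kappa(r):=\sum_{j=1}^3\left(-1+[1+f_\kappa(jr)]^2\right)$. Define $r^*(\kappa):=\sup\{r\in(0,1/3):\rho_\kappa(r')<1\text{ for all }r'\in(0,r)\}$. Constants of $F$: let $J=\{1,\dots,m\}$ index the columns $v_j$ of $F$, $\|\cdot\|$ the Euclidean norm, $\langle\cdot,\cdot\rangle$ the Euclidean inner product, and for $T\subseteq J$ put $F_Tc=\sum_{j\in T}c_jv_j$. For an integer $1\le S\le m$, $\delta_S$ is the smallest quantity such that $(1-\delta_S)\|c\|^2\le\|F_Tc\|^2\le(1+\delta_S)\|c\|^2$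 for all $T\subset J$ with $|T|\le S$ and all real $(c_j)_{j\in T}$. For integers $S,S'\ge1$ with $S+S'\le m$, $\theta_{S,S'}$ is the smallest quantity such that $|\langle F_Tc,F_{T'}c'\rangle|\le\theta_{S,S'}\|c\|\,\|c'\|$ for all disjoint $T,T'\subseteq J$ with $|T|\le S$, $|T'|\le S'$ and all real coefficient vectors $c\in\mathbf{R}^T$, $c'\in\mathbf{R}^{T'}$. *)

(* Defs.v *)
From HB Require Import structures.
From mathcomp Require Import all_boot all_order all_algebra.
From mathcomp Require Import all_classical all_reals all_analysis.

Set Implicit Arguments.
Unset Strict Implicit.
Unset Printing Implicit Defensive.

Import Order.TTheory GRing.Theory Num.Theory.
Import numFieldNormedType.Exports.

Local Open Scope classical_set_scope.
Local Open Scope ring_scope.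

Definition entropy (R : realType) (q : R) : R :=
  - q * ln q - (1 - q) * ln (1 - q).

Definition f_ (R : realType) (kappa q : R) : R :=
  (Num.sqrt kappa)^-1 * (Num.sqrt q + Num.sqrt (2 * entropy q)).

Definition rho (R : realType) (kappa r : R) : R :=
  \sum_(1 <= j < 4) (- 1 + (1 + f_ kappa (j%:R * r)) ^+ 2).

Definition rstar (R : realType) (kappa : R) : R :=
  sup [set r : R | 0 < r < 1 / 3 /\
                   forall r' : R, 0 < r' < r -> rho kappa r' < 1].

(* The library's norm on matrices is the sup norm, hence this explicit Euclidean norm. *)
Definition inner (R : realType) (n : nat) (u v : 'cV[R]_n) : R :=
  \sum_(i < n) u i 0 * v i 0.

Definition enorm (R : realType) (n : nat) (u : 'cV[R]_n) : R :=
  Num.sqrt (inner u u).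

(* A coefficient vector in R^T is a function on all indices of which only the
   values on T are used. *)
Definition coef_norm (R : realType) (m : nat) (T : {set 'I_m})
    (c : 'I_m -> R) : R :=
  Num.sqrt (\sum_(j in T) c j ^+ 2).

Definition restrict_mul (R : realType) (p m : nat) (F : 'M[R]_(p, m))
    (T : {set 'I_m}) (c : 'I_m -> R) : 'cV[R]_p :=
  \sum_(j in T) c j *: col j F.

Definition delta_bound (R : realType) (p m : nat) (F : 'M[R]_(p, m))
    (S : nat) (d : R) : Prop :=
  forall (T : {set 'I_m}) (c : 'I_m -> R), (#|T| <= S)%N ->
    (1 - d) * coef_norm T c ^+ 2 <= enorm (restrict_mul F T c) ^+ 2
      <= (1 + d) * coef_norm T c ^+ 2.

Definition theta_bound (R : realType) (p m : nat) (F : 'M[R]_(p, m))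
    (S S' : nat) (t : R) : Prop :=
  forall (T T' : {set 'I_m}) (c c' : 'I_m -> R), [disjoint T & T']%bool ->
    (#|T| <= S)%N -> (#|T'| <= S')%N ->
    `|inner (restrict_mul F T c) (restrict_mul F T' c')|
      <= t * coef_norm T c * coef_norm T' c'.

(* For 1 <= S <= m (resp. 1 <= S, S' and S + S' <= m) the set below is a
   nonempty closed subset of [0, +oo[, so its infimum is its smallest element. *)
Definition delta (R : realType) (p m : nat) (F : 'M[R]_(p, m)) (S : nat) : R :=
  inf [set d : R | delta_bound F S d].

Definition theta (R : realType) (p m : nat) (F : 'M[R]_(p, m))
    (S S' : nat) : R :=
  inf [set t : R | theta_bound F S S' t].

Definition mutually_independent (R : realType) (d : measure_display)
    (Omega : measurableType d) (P : probability Omega R) (I : finType)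
    (X : I -> {RV P >-> R}) : Prop :=
  forall (J : {set I}) (B : I -> set R), (forall i, measurable (B i)) ->
    P (\bigcap_(i in [set` J]) X i @^-1` B i) =
    (\prod_(i in J) P (X i @^-1` B i))%E.

(* The second argument of normal_prob is the standard deviation.  Laws are
   compared on measurable sets only: on the others the values of the two
   set functions carry no meaning. *)
Definition has_normal_law (R : realType) (d : measure_display)
    (Omega : measurableType d) (P : probability Omega R)
    (X : {RV P >-> R}) (mean variance : R) : Prop :=
  forall B : set R, measurable B ->
    distribution P X B = normal_prob mean (Num.sqrt variance) B.

Definition iid_gaussian_entries (R : realType) (d : measure_display)
    (Omega : measurableType d) (P : probability Omega R) (p m : nat)
    (X : 'I_p -> 'I_m -> {RV P >-> R}) : Prop :=
  mutually_independent (fun ij : 'I_p * 'I_m => X ij.1 ij.2) /\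
  forall i j, has_normal_law (X i j) 0 (p%:R^-1).

Definition random_matrix (R : realType) (d : measure_display)
    (Omega : measurableType d) (P : probability Omega R) (p m : nat)
    (X : 'I_p -> 'I_m -> {RV P >-> R}) (w : Omega) : 'M[R]_(p, m) :=
  \matrix_(i, j) X i j w.

Definition gaussian_whp (R : realType) (kappa r : R) : Prop :=
  exists C c : R, [/\ 0 < C, 0 < c &
    forall m p S : nat, (0 < m)%N ->
      p%:R = kappa * m%:R -> S%:R = r * m%:R ->
    forall (d : measure_display) (Omega : measurableType d)
      (P : probability Omega R) (X : 'I_p -> 'I_m -> {RV P >-> R}),
      iid_gaussian_entries X ->
      ((1 - C * expR (- c * m%:R))%R%:E <=
       P [set w | (delta (random_matrix X w) S
                   + theta (random_matrix X w) S S
                   + theta (random_matrix X w) S (2 * S)%N < 1)%R])%E].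

(* Main.v *)
From HB Require Import structures.
Require Import Defs.
From mathcomp Require Import all_boot all_order all_algebra.
From mathcomp Require Import all_classical all_reals all_analysis.
From mathcomp Require Import measurable_realfun.
From mathcomp Require Import ring lra.

(** The columns of a Gaussian matrix are handled through one quadratic form,
    [defect F c c = |F c|^2 - |c|^2], bounded first at a single vector, then on
    all sparse vectors at once.

    For a fixed [z] the coordinates of [F z] are independent centred Gaussian
    variables of variance [|z|^2 / p], hence [|F z|^2] has an explicit
    exponential moment for both signs of the parameter ([integral_expR_rows]).
    It is computed by integrating out the entries of [F] one at a time: given
    the others, an entry [x] enters through [exp (l (a + b x)^2)], whose
    Gaussian integral is [exp (l' a^2)] up to a constant.  By the exponential
    Markov inequality a relative deviation of [|F z|^2] from [|z|^2] by [x] has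
    probability at most [2 exp (- p x^2 / (4 (1 + x)))] ([rows_sqnorm_tail]).

    The vectors with at most [S] nonzero entries are reached through the net of
    integer vectors of support at most [S] and l1 norm at most [20 S].  Rounding
    towards zero brings each such vector of the unit ball within [1 / 20] of a
    multiple of a net vector lying in the unit ball, and since
    [Q u - Q v = B (u - v, u + v)] for a quadratic form, a deviation [x] on the
    net costs at most [x / (9 / 10)] everywhere ([net_near_isometry]).  One
    generating function counts the supports and the entries simultaneously and
    bounds the net by [exp (m (H q + q ln 107))] when [S <= q m]
    ([card_net_le]).  So the deviation [x / (9 / 10)] has exponentially small
    probability as soon as [H q + q ln 107 < kappa x^2 / (4 (1 + x))].

    By polarization a deviation bound for [S + S'] bounds the correlation
    [theta] of disjoint supports of sizes [S] and [S']
    ([near_isometry_theta_bound]); so the deviations for [S], [2 S] and [3 S]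
    bound the three summands.  Below the threshold the deviations
    [(1 + f (j r))^2 - 1], [j = 1, 2, 3], add up to [rho r < 1], and the point
    is that each of them satisfies the exponent condition ([f_exponent_gap]).
    There is room for this.  The function [f] is tailored to the concentration
    of the Lipschitz function [|F z|], which at deviation [t] gives the exponent
    [p t^2 / 2], whereas the fixed vectors of the net deviate with an exponent
    close to [p t^2].  The factor [2] thus gained on the entropy pays for the
    entries of the net vectors and for the loss of [9 / 10], because
    [(1 + f q)^2 - 1 < 1] forces [q < 3 / 100], and then [H q] is at least
    [3.9 q].  In the three explicit ranges [r] is so small that the deviations
    [1/5], [7/25] and [7/20] satisfy the condition.

    A lower bound on the probability of the event means something only for
    measurable events: [delta] and [theta] are infima of upward closed sets
    of bounds, and each bound is tested on rational coefficients
    ([measurable_delta], [measurable_theta]). *)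

Set Implicit Arguments.
Unset Strict Implicit.
Unset Printing Implicit Defensive.

Import Order.TTheory GRing.Theory Num.Theory.
Import numFieldNormedType.Exports.

Local Open Scope classical_set_scope.
Local Open Scope ring_scope.

(** * Gaussian integrals *)

Lemma ge0_integral_normal_prob (R : realType) (m s : R) (f : R -> \bar R) :
  measurable_fun [set: R] f -> (forall x, 0 <= f x)%E ->
  (\int[normal_prob m s]_x f x =
   \int[lebesgue_measure]_x (f x * (normal_pdf m s x)%:E))%E.
Proof.
move=> mf f0.
have dom := normal_prob_dominates m s.
rewrite -(Radon_Nikodym_SigmaFinite.change_of_variables dom)//.
apply: ae_eq_integral => //.
- apply: emeasurable_funM => //.
  exact: measurable_int (Radon_Nikodym_SigmaFinite.f_integrable dom).
- apply: emeasurable_funM => //.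
  by apply/measurable_EFinP; exact: measurable_normal_pdf.
- apply: ae_eqe_mul2l.
  apply: integral_ae_eq => //.
  + exact: (Radon_Nikodym_SigmaFinite.f_integrable dom).
  + by apply/measurable_EFinP; exact: measurable_normal_pdf.
  + by move=> A _ mA; rewrite -(Radon_Nikodym_SigmaFinite.f_integral dom).
Qed.

(** Completing the square turns the integrand into a multiple of the Gaussian
    density of mean [2 l a b s^2 / v] and standard deviation [s / sqrt v].  The
    result has again the shape [exp (l' a^2)], which lets the computation be
    iterated over the entries of a row. *)
Lemma normal_expR_sqr (R : realType) (s l a b : R) : 0 < s ->
    2 * l * b ^+ 2 * s ^+ 2 < 1 ->
  let v := 1 - 2 * l * b ^+ 2 * s ^+ 2 in
  (\int[normal_prob 0 s]_x (expR (l * (a + b * x) ^+ 2))%:E =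
   ((Num.sqrt v)^-1 * expR (l * a ^+ 2 / v))%:E)%E.
Proof.
move=> s0 lt1 v.
have v0 : 0 < v by rewrite /v; lra.
pose t := s / Num.sqrt v.
pose u := 2 * l * a * b * s ^+ 2 / v.
have sv0 : 0 < Num.sqrt v by rewrite sqrtr_gt0.
have t0 : 0 < t by rewrite divr_gt0.
have t2 : t ^+ 2 = s ^+ 2 / v by rewrite /t expr_div_n sqr_sqrtr// ltW.
rewrite ge0_integral_normal_prob//; last first.
  apply/measurable_EFinP; apply: measurableT_comp => //.
  apply: measurable_funM => //; apply: measurable_funX.
  by apply: measurable_funD => //; exact: measurable_funM.
have density_sqr x : ((expR (l * (a + b * x) ^+ 2))%:E * (normal_pdf 0 s x)%:E =
    ((Num.sqrt v)^-1 * expR (l * a ^+ 2 / v))%:E * (normal_pdf u t x)%:E)%E.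
  rewrite -!EFinM; congr EFin.
  rewrite !normal_pdfE ?gt_eqF// /normal_fun /normal_peak.
  move: (pi_gt0 R); move: (pi : R) => c c0.
  have -> : t ^+ 2 * c *+ 2 = (s ^+ 2 * c *+ 2) / v by rewrite t2 mulrAC mulrnAl.
  have sc0 : 0 < s ^+ 2 * c *+ 2 by rewrite mulrn_wgt0// mulr_gt0// exprn_gt0.
  rewrite sqrtrM ?(ltW sc0)// sqrtrV ?(ltW v0)// invf_div.
  have scv : Num.sqrt (s ^+ 2 * c *+ 2) != 0 by rewrite gt_eqF// sqrtr_gt0.
  move: (Num.sqrt (s ^+ 2 * c *+ 2)) scv => w w0.
  transitivity (w^-1 *
     (expR (l * (a + b * x) ^+ 2) * expR (- (x - 0) ^+ 2 / (s ^+ 2 *+ 2)))).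
    by rewrite mulrCA mulrA mulrC mulrA.
  rewrite -expRD.
  transitivity (w^-1 *
    (expR (l * a ^+ 2 / v) * expR (- (x - u) ^+ 2 / (t ^+ 2 *+ 2)))); last first.
    by field; rewrite w0 gt_eqF.
  rewrite -expRD; congr (_ * expR _).
  rewrite t2 /u.
  have -> : - (x - 0) ^+ 2 / (s ^+ 2 *+ 2) =
      - x ^+ 2 * (v + 2 * l * b ^+ 2 * s ^+ 2) / (2 * s ^+ 2).
    by rewrite /v -mulr_natr; field; rewrite gt_eqF.
  have -> : l * a ^+ 2 / v = l * a ^+ 2 * (v + 2 * l * b ^+ 2 * s ^+ 2) / v.
    by rewrite /v; congr (_ / _); ring.
  rewrite -(mulr_natr (s ^+ 2 / v)).
  by move: v0 => /lt0r_neq0; clearbody v => v0; field; rewrite v0 gt_eqF.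
under eq_integral do rewrite density_sqr.
have z0 : 0 <= (Num.sqrt v)^-1 * expR (l * a ^+ 2 / v).
  by rewrite mulr_ge0 ?expR_ge0// invr_ge0 ltW.
rewrite ge0_integralZl//.
- by rewrite integral_normal_pdf mule1.
- by apply/measurable_EFinP; exact: measurable_normal_pdf.
- by move=> x _; rewrite lee_fin normal_pdf_ge0.
Qed.

(** * Substituting an independent copy for one variable *)

Section independence.
Context (R : realType) (d : measure_display) (Omega : measurableType d).
Context (P : probability Omega R) (I : finType) (X : I -> {RV P >-> R}).
Hypothesis indepX : mutually_independent X.

(** These sets form a pi-system that generates the sigma-algebra of the
    variables of index in [K]. *)
Definition cylinders (K : {set I}) : set (set Omega) :=
  [set A | exists2 B : I -> set R, (forall i, measurable (B i)) &
     A = \bigcap_(i in [set` K]) X i @^-1` B i].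

Lemma cylinders_setI K : setI_closed (cylinders K).
Proof.
move=> _ _ [B mB ->] [C mC ->]; exists (fun i => B i `&` C i).
  by move=> i; exact: measurableI.
by rewrite -bigcapI; apply: eq_bigcapr => i _; rewrite preimage_setI.
Qed.

Lemma cylinders_setT K : cylinders K setT.
Proof.
exists (fun=> setT) => //; apply/esym.
by rewrite -subTset => w _ i _.
Qed.

Lemma cylinders_measurable K A : cylinders K A -> measurable A.
Proof.
move=> [B mB ->]; apply: fin_bigcap_measurable => //= i _.
by rewrite -[X in measurable X]setTI; exact: measurable_funPT.
Qed.

Local Notation OmegaK K := (g_sigma_algebraType (cylinders K)).

Lemma measurable_idK K : measurable_fun setT (idfun : Omega -> OmegaK K).
Proof.
move=> _ A sA; rewrite setTI.
apply: (smallest_sub _ _ sA); first exact: sigma_algebra_measurable.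
exact: cylinders_measurable.
Qed.

Lemma measurable_coordK (K : {set I}) i : i \in K ->
  measurable_fun setT (X i : OmegaK K -> R).
Proof.
move=> iK _ B mB; rewrite setTI; apply: sub_sigma_algebra.
exists (fun j => if j == i then B else setT).
  by move=> j; case: ifP.
rewrite eqEsubset; split => [w Bw j jK /=|w /(_ i iK)/=]; last by rewrite eqxx.
by case: eqP => // ->.
Qed.

Lemma cylinder_indep (K : {set I}) k A B :
  k \notin K -> cylinders K A -> measurable B ->
  P (A `&` X k @^-1` B) = (P A * P (X k @^-1` B))%E.
Proof.
move=> kK [C mC ->] mB.
pose D i := if i == k then B else C i.
have mD i : measurable (D i) by rewrite /D; case: ifP.
have -> : \bigcap_(i in [set` K]) X i @^-1` C i =
    \bigcap_(i in [set` K]) X i @^-1` D i.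
  apply: eq_bigcapr => i /= iK; rewrite /D ifN//.
  by apply: contraNneq kK => <-.
have -> : B = D k by rewrite /D eqxx.
rewrite (_ : _ `&` _ = \bigcap_(i in [set` (k |: K)]) X i @^-1` D i); last first.
  rewrite eqEsubset; split => [w [Kw kw] i /=|w /= kKw].
    by rewrite !inE => /orP[/eqP->//|]; exact: Kw.
  split; last by apply: kKw => /=; rewrite setU11.
  by move=> i iK; apply: kKw => /=; rewrite inE (_ : i \in K) ?orbT.
by rewrite !indepX// big_setU1//= muleC.
Qed.

(** Both sides are finite measures in [A] that agree on the cylinders. *)
Lemma sigma_indep (K : {set I}) k (A : set Omega) B :
  k \notin K -> <<s cylinders K >> A -> measurable B ->
  P (A `&` X k @^-1` B) = (P A * P (X k @^-1` B))%E.
Proof.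
move=> kK sA mB.
have mXB : measurable (X k @^-1` B).
  by rewrite -[X in measurable X]setTI; exact: measurable_funPT.
have Bfin : P (X k @^-1` B) \is a fin_num by exact: fin_num_measure.
have B0 : 0 <= fine (P (X k @^-1` B)) by rewrite fine_ge0.
suff : mrestr P mXB A = mscale (NngNum B0) P A.
  by rewrite /mrestr /mscale/= fineK// muleC.
apply: (g_sigma_algebra_measure_unique (cylinders K)
    (@cylinders_measurable K) (fun=> setT) (fun=> cylinders_setT K)) => //.
- by rewrite bigcup_const//; exists 0%N.
- exact: cylinders_setI.
- move=> C cC; rewrite /= /mrestr /mscale /= (cylinder_indep kK cC mB).
  by rewrite fineK// muleC.
- move=> _; rewrite /= /mrestr (le_lt_trans (probability_le1 _ _)) ?ltry//.
  exact: measurableI.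
Qed.

(** The pair of the identity, seen as a map to [Omega] with the smaller
    sigma-algebra, and of [X k] has a product law; Tonelli's theorem then
    integrates [X k] out. *)
Lemma ge0_integral_indep (K : {set I}) k (mu : probability (measurableTypeR R) R)
    (h : OmegaK K * measurableTypeR R -> \bar R) :
  k \notin K -> (forall B, measurable B -> P (X k @^-1` B) = mu B) ->
  measurable_fun setT h -> (forall z, 0 <= h z)%E ->
  (\int[P]_w h (w, X k w) = \int[P]_w \int[mu]_x h (w, x))%E.
Proof.
move=> kK lawk mh h0.
pose idK : {mfun Omega >-> OmegaK K} :=
  HB.pack (idfun : Omega -> OmegaK K)
    (isMeasurableFun.Build _ _ _ _ _ (@measurable_idK K)).
pose pairX : Omega -> OmegaK K * measurableTypeR R := fun w => (w, X k w).
have mpairX : measurable_fun setT pairX.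
  apply: measurable_fun_pair; first exact: measurable_idK.
  exact: (@measurable_funPT _ _ _ _ (X k)).
pose phi : {mfun Omega >-> (OmegaK K * measurableTypeR R)%type} :=
  HB.pack pairX (isMeasurableFun.Build _ _ _ _ _ mpairX).
pose PK := distribution P idK.
pose PX := distribution P phi.
have PXE : forall Z, measurable Z -> (PK \x mu)%E Z = PX Z.
  apply: product_measure_unique => A B mA mB.
  by have := sigma_indep kK mA mB; rewrite (lawk _ mB).
transitivity (\int[PX]_z h z)%E.
  by rewrite ge0_integral_distribution.
transitivity (\int[PK \x mu]_z h z)%E.
  by apply: eq_measure_integral => Z mZ _; have := PXE _ mZ.
rewrite fubini_tonelli1// ge0_integral_distribution//.
- exact: measurable_fun_fubini_tonelli_F.
- by move=> w; apply: integral_ge0.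
Qed.

End independence.

(** * The exponential moment of the squared norm of the image of a vector *)

Section gaussian_mgf.
Context (R : realType) (d : measure_display) (Omega : measurableType d).
Context (P : probability Omega R) (p m : nat).
Context (X : 'I_p * 'I_m -> {RV P >-> R}) (s : R) (z : 'I_m -> R).
Hypothesis indepX : mutually_independent X.
Hypothesis s0 : 0 < s.
Hypothesis lawX : forall ij B, measurable B ->
  P (X ij @^-1` B) = normal_prob 0 s B.

Implicit Types (J : {set 'I_p * 'I_m}) (i : 'I_p) (j : 'I_m).

Definition partial_row (J : {set 'I_p * 'I_m}) (i : 'I_p) (w : Omega) : R :=
  \sum_(j | (i, j) \in J) z j * X (i, j) w.

Definition partial_sqnorm (J : {set 'I_p * 'I_m}) (i : 'I_p) : R :=
  \sum_(j | (i, j) \in J) z j ^+ 2.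

Lemma partial_sqnorm_ge0 J i : 0 <= partial_sqnorm J i.
Proof. by apply: sumr_ge0 => j _; exact: sqr_ge0. Qed.

Lemma measurable_partial_row J i :
  measurable_fun setT (partial_row J i : g_sigma_algebraType (cylinders X J) -> R).
Proof.
rewrite /partial_row.
pose f j : g_sigma_algebraType (cylinders X J) -> R :=
  if (i, j) \in J then fun w => z j * X (i, j) w else cst 0.
rewrite (_ : (fun _ => _) = fun w => \sum_j f j w); last first.
  apply/funext => w; rewrite big_mkcond; apply: eq_bigr => j _.
  by rewrite /f; case: ifP.
apply: measurable_sum => j; rewrite /f; case: ifPn => // ijJ.
apply: measurable_funM => //; exact: measurable_coordK.
Qed.

Lemma partial_row_setD1 J i j : (i, j) \in J -> forall i' w,
  partial_row J i' w =
  partial_row (J :\ (i, j)) i' w + (if i' == i then z j * X (i, j) w else 0).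
Proof.
move=> ijJ i' w; rewrite /partial_row.
case: eqVneq => [->|ne].
  rewrite (bigD1 j)//= addrC; congr (_ + _); apply: eq_bigl => k.
  by rewrite !inE xpair_eqE eqxx/= andbC.
rewrite addr0; apply: eq_bigl => k.
by rewrite !inE xpair_eqE (negbTE ne).
Qed.

Lemma partial_sqnorm_setD1 J i j : (i, j) \in J -> forall i',
  partial_sqnorm J i' =
  partial_sqnorm (J :\ (i, j)) i' + (if i' == i then z j ^+ 2 else 0).
Proof.
move=> ijJ i'; rewrite /partial_sqnorm.
case: eqVneq => [->|ne].
  rewrite (bigD1 j)//= addrC; congr (_ + _); apply: eq_bigl => k.
  by rewrite !inE xpair_eqE eqxx/= andbC.
rewrite addr0; apply: eq_bigl => k.
by rewrite !inE xpair_eqE (negbTE ne).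
Qed.

(** Induction on the number of entries.  The rows carry different parameters
    [l i], because integrating out an entry of row [i] replaces [l i] by
    [l i / v] and leaves the other rows unchanged. *)
Lemma integral_expR_partial_rows J (l : 'I_p -> R) :
  (forall i, 2 * l i * s ^+ 2 * partial_sqnorm J i < 1) ->
  (\int[P]_w (expR (\sum_i l i * partial_row J i w ^+ 2))%:E =
   (\prod_i (Num.sqrt (1 - 2 * l i * s ^+ 2 * partial_sqnorm J i))^-1)%:E)%E.
Proof.
have [n] := ubnP #|J|; elim: n J l => // n IH J l cardJ ub.
have [->|[[i j] ijJ]] := set_0Vmem J.
  rewrite (_ : (fun _ => _) = cst 1%E).
    rewrite integral_cst//= probability_setT mule1; congr EFin.
    rewrite big1// => i _; rewrite /partial_sqnorm big_pred0.
      by rewrite mulr0 subr0 sqrtr1 invr1.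
    by move=> j; rewrite inE.
  apply/funext => w /=; rewrite big1 ?expR0// => i _.
  rewrite /partial_row big_pred0 ?expr0n ?mulr0// => j.
  by rewrite inE.
set K := J :\ (i, j).
have ijK : (i, j) \notin K by rewrite !inE eqxx.
have K0 := partial_sqnorm_ge0 K i.
pose v := 1 - 2 * l i * z j ^+ 2 * s ^+ 2.
have v0 : 0 < v.
  have := ub i; rewrite (partial_sqnorm_setD1 ijJ) eqxx -/K => ubi.
  rewrite /v; have [li0|li0] := leP 0 (l i).
    apply: lt_le_trans
      (_ : 0 < 1 - 2 * l i * s ^+ 2 * (partial_sqnorm K i + z j ^+ 2)) _.
      by rewrite subr_gt0.
    rewrite lerD2l lerN2 -[leLHS]mulrA -[leRHS]mulrA ler_wpM2l ?mulr_ge0//.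
    by rewrite mulrC ler_wpM2l ?sqr_ge0// lerDr.
  have zs0 : 0 <= z j ^+ 2 * s ^+ 2 by rewrite mulr_ge0 ?sqr_ge0.
  have : l i * (z j ^+ 2 * s ^+ 2) <= 0 by rewrite mulr_le0_ge0 ?(ltW li0).
  by move: (z j ^+ 2) (s ^+ 2) => a b; lra.
pose l' i' := if i' == i then l i / v else l i'.
(* the integrand, with the entry that is integrated out as a free variable *)
pose h (q : g_sigma_algebraType (cylinders X K) * measurableTypeR R) : \bar R :=
  (expR (l i * (partial_row K i q.1 + z j * q.2) ^+ 2 +
     \sum_(i' | i' != i) l i' * partial_row K i' q.1 ^+ 2))%:E.
transitivity (\int[P]_w h (w, X (i, j) w))%E.
  apply: eq_integral => w _; rewrite /h /=; congr (EFin (expR _)).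
  rewrite (bigD1 i)//=; congr (_ + _).
    by rewrite (partial_row_setD1 ijJ) eqxx.
  apply: eq_bigr => i' ne; rewrite (partial_row_setD1 ijJ) (negbTE ne) addr0//.
have mrow i' : measurable_fun setT
    (fun q : g_sigma_algebraType (cylinders X K) * measurableTypeR R =>
       partial_row K i' q.1).
  have mr := @measurable_partial_row K i'.
  by apply: (measurableT_comp mr); exact: measurable_fst.
rewrite (ge0_integral_indep indepX ijK (lawX (i, j))); last 2 first.
- apply/measurable_EFinP; apply: measurableT_comp => //; apply: measurable_funD.
    apply: measurable_funM => //; apply: measurable_funX.
    by apply: measurable_funD => //; apply: measurable_funM.
  rewrite (_ : (fun _ => _) = fun q : g_sigma_algebraType (cylinders X K) *
      measurableTypeR R => \sum_(i' <- [seq i' <- index_enum 'I_p | i' != i])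
        l i' * partial_row K i' q.1 ^+ 2); last first.
    by apply/funext => q; rewrite big_filter.
  apply: measurable_sum => i'.
  by apply: measurable_funM => //; exact: measurable_funX.
- by move=> q; rewrite lee_fin expR_ge0.
have inner_int w : (\int[normal_prob 0 s]_x h (w, x) =
   ((Num.sqrt v)^-1)%:E * (expR (\sum_i' l' i' * partial_row K i' w ^+ 2))%:E)%E.
  rewrite /h /=; under eq_integral do rewrite expRD EFinM.
  rewrite ge0_integralZr//; last first.
    by apply/measurable_EFinP/measurableT_comp => //; apply: measurable_funM => //;
      apply: measurable_funX; apply: measurable_funD => //; exact: measurable_funM.
  rewrite normal_expR_sqr//; last by rewrite -subr_gt0.
  rewrite -/v -!EFinM; congr EFin.
  rewrite -[LHS]mulrA -expRD; congr (_ * expR _).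
  rewrite [RHS](bigD1 i)//= /l' eqxx; congr (_ + _).
    by rewrite mulrAC.
  by apply: eq_bigr => i' /negbTE ->.
under eq_integral do rewrite inner_int.
rewrite ge0_integralZl//; last first.
  apply/measurable_EFinP; apply: measurableT_comp => //.
  apply: measurable_sum => i'; apply: measurable_funM => //.
  apply: measurable_funX.
  have mr := @measurable_partial_row K i'.
  exact: (measurableT_comp mr (@measurable_idK _ _ _ _ _ X K)).
(* so the factor of row i splits into that of v and that of the shorter row *)
have v_row : 1 - 2 * (l i / v) * s ^+ 2 * partial_sqnorm K i =
    (1 - 2 * l i * s ^+ 2 * partial_sqnorm J i) / v.
  rewrite (partial_sqnorm_setD1 ijJ) eqxx -/K.
  move: v0 => /lt0r_neq0; rewrite /v => vn0.
  by field.
rewrite IH; last 2 first.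
- by rewrite (leq_trans _ (ltnSE cardJ))// /K [in X in (_ < X)%N](cardsD1 (i, j)) ijJ.
- move=> i'; rewrite /l'; case: eqVneq => [->|ne].
    by rewrite -subr_gt0 v_row divr_gt0// subr_gt0.
  by have := ub i'; rewrite (partial_sqnorm_setD1 ijJ) (negbTE ne) addr0.
rewrite -EFinM; congr EFin; rewrite (bigD1 i)//= [RHS](bigD1 i)//= mulrA.
congr (_ * _).
  rewrite /l' eqxx v_row sqrtrM ?subr_ge0 ?ltW ?ub// sqrtrV ?(ltW v0)//.
  by rewrite invf_div mulrA mulVf ?mul1r// gt_eqF// sqrtr_gt0.
apply: eq_bigr => i' ne.
by rewrite (partial_sqnorm_setD1 ijJ) (negbTE ne) addr0 /l' (negbTE ne).
Qed.

Definition rows_sqnorm (w : Omega) : R := \sum_i (\sum_j z j * X (i, j) w) ^+ 2.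

Lemma integral_expR_rows (l : R) :
  2 * l * s ^+ 2 * (\sum_j z j ^+ 2) < 1 ->
  (\int[P]_w (expR (l * rows_sqnorm w))%:E =
   ((Num.sqrt (1 - 2 * l * s ^+ 2 * (\sum_j z j ^+ 2)))^-1 ^+ p)%:E)%E.
Proof.
move=> lt1.
have sqT i : partial_sqnorm [set: 'I_p * 'I_m]%SET i = \sum_j z j ^+ 2.
  by apply: eq_bigl => j; rewrite inE.
have := @integral_expR_partial_rows [set: 'I_p * 'I_m]%SET (fun=> l).
have -> : (Num.sqrt (1 - 2 * l * s ^+ 2 * (\sum_j z j ^+ 2)))^-1 ^+ p =
    \prod_(i < p) (Num.sqrt (1 - 2 * l * s ^+ 2 *
      partial_sqnorm [set: 'I_p * 'I_m]%SET i))^-1.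
  by under [RHS]eq_bigr do rewrite sqT; rewrite prodr_const card_ord.
move=> <-; last by move=> i; rewrite sqT.
apply: eq_integral => w _; congr (expR _)%:E.
rewrite mulr_sumr; apply: eq_bigr => i _; congr (_ * _ ^+ 2).
by apply: eq_bigl => j; rewrite inE.
Qed.

End gaussian_mgf.

(** * Deviation of the squared norm at a fixed vector *)

Lemma ge0_is_derive_le (R : realType) (f df : R -> R) (a b : R) : a <= b ->
  (forall x, a <= x -> is_derive x 1 f (df x)) ->
  (forall x, a <= x -> 0 <= df x) -> f a <= f b.
Proof.
move=> ab dfx df0.
have [||c + fab] := @MVT_segment R f df a b ab.
- by move=> x; rewrite in_itv/= => /andP[/ltW ax _]; exact: dfx.
- apply: derivable_within_continuous => x; rewrite in_itv/= => /andP[ax _].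
  by have [] := dfx _ ax.
rewrite in_itv/= => /andP[ac _].
by rewrite -subr_ge0 fab mulr_ge0 ?df0// subr_ge0.
Qed.

(** This is [u <= sinh u] at [u = ln t]. *)
Lemma ln_le_sinh (R : realType) (t : R) : 1 <= t -> ln t <= (t - t^-1) / 2.
Proof.
move=> t1; have t0 : 0 < t by exact: lt_le_trans t1.
have u0 : 0 <= ln t by rewrite ln_ge0.
have := @ge0_is_derive_le R (fun u => expR u - expR (- u) - 2 * u)
  (fun u => expR u + expR (- u) - 2) 0 (ln t) u0.
rewrite oppr0 expR0 mulr0 subr0 subrr expRN lnK ?posrE// => H.
suff : 0 <= t - t^-1 - 2 * ln t by lra.
apply: H => x x0.
  have dN : is_derive x 1 (fun u : R => expR (- u)) (- expR (- x)).
    by rewrite -mulrN1; exact: is_derive1_comp.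
  by apply: is_derive_eq => /=; rewrite scaler1 opprK.
rewrite expRN; move: (expR_gt0 x); move: (expR x) => e e0.
have -> : e + e^-1 - 2 = (e - 1) ^+ 2 / e by field; rewrite gt_eqF.
by rewrite divr_ge0 ?sqr_ge0// ltW.
Qed.

Lemma ln1D_ge (R : realType) (s : R) : 0 <= s -> s - s ^+ 2 / 2 <= ln (1 + s).
Proof.
move=> s0.
have := @ge0_is_derive_le R (fun u => ln (1 + u) - u + u ^+ 2 / 2)
  (fun u => (1 + u)^-1 - 1 + u) 0 s s0.
rewrite addr0 ln1 expr0n/= mul0r subr0 addr0 => H.
suff : 0 <= ln (1 + s) - s + s ^+ 2 / 2 by lra.
apply: H => x x0.
  have x1 : 0 < 1 + x by lra.
  have dl : is_derive x 1 (fun u : R => ln (1 + u)) (1 + x)^-1.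
    rewrite -[_^-1]mulr1; apply: is_derive1_comp.
      exact: is_derive1_ln.
    have := is_deriveD (is_derive_cst (1 : R) x 1) (is_derive_id x 1).
    by rewrite add0r.
  apply: is_derive_eq; rewrite !scaler0 add0r /GRing.scale/= !mulr1.
  by congr (_ + _); lra.
have -> : (1 + x)^-1 - 1 + x = x ^+ 2 / (1 + x) by field; lra.
by rewrite divr_ge0 ?sqr_ge0//; lra.
Qed.

Lemma measurable_superlevel (R : realType) (d : measure_display)
    (T : measurableType d) (f : T -> R) (a : R) :
  measurable_fun setT f -> measurable [set w | a <= f w].
Proof.
move=> mf; rewrite (_ : mkset _ = setT `&` f @^-1` `[a, +oo[%classic).
  exact: mf.
by rewrite setTI; apply/seteqP; split => w /=; rewrite in_itv/= andbT.
Qed.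

Section gaussian_tail.
Context (R : realType) (d : measure_display) (Omega : measurableType d).
Context (P : probability Omega R) (p m : nat).
Context (X : 'I_p * 'I_m -> {RV P >-> R}) (z : 'I_m -> R).
Hypothesis indepX : mutually_independent X.
Hypothesis p0 : (0 < p)%N.
Hypothesis lawX : forall ij B, measurable B ->
  P (X ij @^-1` B) = normal_prob 0 (Num.sqrt p%:R^-1) B.

Let N := \sum_j z j ^+ 2.
Hypothesis N0 : 0 < N.

Lemma measurable_rows_sqnorm : measurable_fun setT (rows_sqnorm X z).
Proof.
apply: measurable_sum => i; apply: measurable_funX; apply: measurable_sum => j.
by apply: measurable_funM => //; exact: measurable_funPT.
Qed.

Let sp0 : 0 < Num.sqrt (p%:R^-1) :> R.
Proof. by rewrite sqrtr_gt0 invr_gt0 ltr0n. Qed.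

Lemma chernoff_rows (l a : R) : 2 * l * p%:R^-1 * N < 1 ->
  (P [set w | a <= l * rows_sqnorm X z w]%R <=
   (expR (- a - p%:R * ln (1 - 2 * l * p%:R^-1 * N) / 2))%:E)%E.
Proof.
move=> l1.
have sp2 : Num.sqrt (p%:R^-1) ^+ 2 = p%:R^-1 :> R.
  by rewrite sqr_sqrtr// invr_ge0.
pose Y w := l * rows_sqnorm X z w.
have mY : measurable_fun setT Y.
  by apply: measurable_funM => //; exact: measurable_rows_sqnorm.
pose Yrv : {RV P >-> R} := HB.pack Y (isMeasurableFun.Build _ _ _ _ _ mY).
have := chernoff Yrv a ltr01; rewrite /mmt_gen_fun unlock/= mul1r.
under eq_integral do rewrite /= mulr1 /Y.
rewrite (integral_expR_rows indepX sp0 lawX) ?sp2// -EFinM => /le_trans; apply.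
rewrite lee_fin (addrC (- a)) expRD ler_wpM2r ?expR_ge0//.
have v0 : 0 < 1 - 2 * l * p%:R^-1 * N by rewrite subr_gt0.
rewrite -/N; move: (1 - 2 * l * p%:R^-1 * N) v0 => v v0.
have -> : (Num.sqrt v)^-1 = expR (- ln v / 2).
  have -> : v = expR (ln v / 2) ^+ 2.
    by rewrite -expRM_natr divfK ?lnK ?posrE ?pnatr_eq0.
  rewrite sqrtr_sqr ger0_norm ?expR_ge0// -expRN -expRM_natr expRK.
  by congr expR; lra.
by rewrite -expRM_natl ler_expR; lra.
Qed.

(** The parameter of the upper deviation is the optimal one, [x / (1 + x)] in
    units of [p / (2 N)]; it gives the exponent [p (x - ln (1 + x)) / 2], bounded
    by [ln_le_sinh].  For the lower deviation the choice [- x] makes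
    [1 + x] appear and [ln1D_ge] gives the exponent [p x^2 / 4]. *)
Lemma rows_sqnorm_tail (x : R) : 0 < x ->
  (P [set w | x * N <= `|rows_sqnorm X z w - N| ]%R <=
   (2 * expR (- (p%:R * (x ^+ 2 / (4 * (1 + x))))))%:E)%E.
Proof.
move=> x0.
pose A := [set w |
  p%:R * x / 2 <= (p%:R * (x / (1 + x)) / (2 * N)) * rows_sqnorm X z w].
pose B := [set w |
  - (p%:R * x * (1 - x) / 2) <= (- (p%:R * x / (2 * N))) * rows_sqnorm X z w].
have mY := measurable_rows_sqnorm.
have mh l a : measurable [set w | a <= l * rows_sqnorm X z w].
  by apply: measurable_superlevel; exact: measurable_funM.
have pn0 : p%:R != 0 :> R by rewrite pnatr_eq0 -lt0n.
have p0R : 0 < p%:R :> R by rewrite ltr0n.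
have x1 : 0 < 1 + x by lra.
have Nn0 : N != 0 by rewrite gt_eqF.
have xn0 : 1 + x != 0 by rewrite gt_eqF.
apply: (@le_trans _ _ (P (A `|` B))).
  apply: le_measure; rewrite ?inE//.
  - apply: measurable_superlevel; apply: measurableT_comp => //.
    exact: measurable_funB.
  - by apply: measurableU; exact: mh.
  - move=> w /=; rewrite /A /B /=; move: (rows_sqnorm X z w) => y.
    rewrite ler_normr => /orP[yN|yN]; [left|right].
      rewrite (_ : p%:R * x / 2 = p%:R * (x / (1 + x)) / (2 * N) * ((1 + x) * N)).
        apply: ler_wpM2l; last by lra.
        by rewrite !(divr_ge0, mulr_ge0)// ltW.
      by field; rewrite ?xn0 ?Nn0 ?pn0.
    rewrite !mulNr lerN2.
    rewrite (_ : p%:R * x * (1 - x) / 2 = p%:R * x / (2 * N) * ((1 - x) * N)).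
      apply: ler_wpM2l; last by lra.
      by rewrite !(divr_ge0, mulr_ge0)// ltW.
    by field; rewrite ?Nn0.
apply: (le_trans (measureU2 _ (mh _ _) (mh _ _))) => /=.
set E := expR _.
have -> : (2 * E)%:E = (E%:E + E%:E)%E by rewrite -EFinD mulr_natl mulr2n.
apply: leeD.
  apply: le_trans (chernoff_rows _ _) _.
    rewrite (_ : _ * N = x / (1 + x)); last first.
      by field; rewrite ?xn0 ?Nn0 ?pn0.
    by rewrite ltr_pdivrMr; lra.
  rewrite lee_fin ler_expR.
  have -> : 1 - 2 * (p%:R * (x / (1 + x)) / (2 * N)) / p%:R * N = (1 + x)^-1.
    by field; rewrite ?xn0 ?Nn0 ?pn0.
  rewrite lnV ?posrE//.
  have := @ln_le_sinh R (1 + x); move: (ln (1 + x)) => y.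
  have -> : (1 + x - (1 + x)^-1) / 2 = x - x ^+ 2 / (2 * (1 + x)).
    by field; rewrite ?xn0.
  have -> : p%:R * (x ^+ 2 / (4 * (1 + x))) = p%:R * (x ^+ 2 / (2 * (1 + x))) / 2.
    by field; rewrite ?xn0.
  have x1' : 1 <= 1 + x by lra.
  move=> /(_ x1') yx.
  have : p%:R * y <= p%:R * (x - x ^+ 2 / (2 * (1 + x))) by rewrite ler_wpM2l// ltW.
  by rewrite mulrBr; lra.
apply: le_trans (chernoff_rows _ _) _.
  rewrite (_ : _ * N = - x); last by field; rewrite ?xn0 ?Nn0 ?pn0.
  by lra.
rewrite lee_fin ler_expR.
have -> : 1 - 2 * (- (p%:R * x / (2 * N))) / p%:R * N = 1 + x.
  by field; rewrite ?xn0 ?Nn0 ?pn0.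
have := @ln1D_ge R x (ltW x0); move: (ln (1 + x)) => y xy.
have : p%:R * (x - x ^+ 2 / 2) <= p%:R * y by rewrite ler_wpM2l// ltW.
have : p%:R * (x ^+ 2 / (4 * (1 + x))) <= p%:R * (x ^+ 2 / 4).
  rewrite ler_wpM2l ?(ltW p0R)// ler_wpM2l ?sqr_ge0// lef_pV2 ?posrE; lra.
by move: (x ^+ 2 / (4 * (1 + x))) => g; lra.
Qed.

End gaussian_tail.

(** * The isometry defect and its polar form *)

Section isometry_defect.
Context (R : realType) (p m : nat).
Implicit Types (F : 'M[R]_(p, m)) (a b c : 'I_m -> R) (T : {set 'I_m}).

Definition dotp a b : R := \sum_j a j * b j.
Definition image_dotp F a b : R :=
  \sum_i (\sum_j a j * F i j) * (\sum_j b j * F i j).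
Definition defect F a b : R := image_dotp F a b - dotp a b.
(** In [delta_bound] and [theta_bound] a coefficient vector on [T] is a function
    of which only the values on [T] are used; extending it by zero turns the
    norms and products restricted to [T] into unrestricted sums. *)
Definition zero_out T c : 'I_m -> R := fun j => if j \in T then c j else 0.
Definition supported T c : Prop := forall j, j \notin T -> c j = 0.

Lemma dotp_ge0 a : 0 <= dotp a a.
Proof. by apply: sumr_ge0 => j _; rewrite -expr2 sqr_ge0. Qed.

Lemma dotp0_eq0 a : dotp a a = 0 -> forall j, a j = 0.
Proof.
move=> /eqP; rewrite psumr_eq0; last by move=> j _; rewrite -expr2 sqr_ge0.
move=> /allP a0 j; have := a0 j (mem_index_enum _).
by rewrite -expr2 sqrf_eq0 => /eqP.
Qed.

Lemma dotp_lin (x y x' y' : R) a b :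
  dotp (fun j => x * a j + y * b j) (fun j => x' * a j + y' * b j) =
  x * x' * dotp a a + (x * y' + y * x') * dotp a b + y * y' * dotp b b.
Proof. by rewrite /dotp !mulr_sumr -!big_split/=; apply: eq_bigr => j _; ring. Qed.

Lemma image_dotp_lin F (x y x' y' : R) a b :
  image_dotp F (fun j => x * a j + y * b j) (fun j => x' * a j + y' * b j) =
  x * x' * image_dotp F a a + (x * y' + y * x') * image_dotp F a b
    + y * y' * image_dotp F b b.
Proof.
rewrite /image_dotp !mulr_sumr -!big_split/=; apply: eq_bigr => i _.
have row (u v : R) : \sum_j (u * a j + v * b j) * F i j =
    u * (\sum_j a j * F i j) + v * (\sum_j b j * F i j).
  by rewrite !mulr_sumr -big_split/=; apply: eq_bigr => j _; ring.
by rewrite !row; ring.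
Qed.

Lemma defect_lin F (x y x' y' : R) a b :
  defect F (fun j => x * a j + y * b j) (fun j => x' * a j + y' * b j) =
  x * x' * defect F a a + (x * y' + y * x') * defect F a b + y * y' * defect F b b.
Proof. by rewrite /defect dotp_lin image_dotp_lin; ring. Qed.

Lemma defectZ F (x : R) a : defect F (fun j => x * a j) (fun j => x * a j) =
  x ^+ 2 * defect F a a.
Proof.
have := defect_lin F x 0 x 0 a a.
rewrite !(mulr0, mul0r, addr0) => <-.
by congr defect; apply/funext => j; rewrite mul0r addr0.
Qed.

Lemma dotpZ (x : R) a : dotp (fun j => x * a j) (fun j => x * a j) =
  x ^+ 2 * dotp a a.
Proof. by rewrite /dotp mulr_sumr; apply: eq_bigr => j _; ring. Qed.

Lemma defect0 F a b : (forall j, a j = 0) -> defect F a b = 0.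
Proof.
move=> a0; rewrite /defect /image_dotp /dotp !big1 ?subrr// => i _.
  by rewrite a0 mul0r.
by rewrite big1 ?mul0r// => j _; rewrite a0 mul0r.
Qed.

Lemma defectC F a b : defect F a b = defect F b a.
Proof.
by congr (_ - _); apply: eq_bigr => i _; rewrite mulrC.
Qed.

Lemma defect_polar F (s t : R) a b : 4 * (s * t) * defect F a b =
  defect F (fun j => s * a j + t * b j) (fun j => s * a j + t * b j) -
  defect F (fun j => s * a j + (- t) * b j) (fun j => s * a j + (- t) * b j).
Proof. by rewrite !defect_lin; ring. Qed.

(** The free scalars [s] and [t] balance the two vectors, which replaces the
    normalization to unit length. *)
Lemma defect_polar_le F T (q s t : R) a b :
  (forall c, supported T c -> `|defect F c c| <= q * dotp c c) ->
  supported T a -> supported T b ->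
  `|4 * (s * t) * defect F a b| <= 2 * q * (s ^+ 2 * dotp a a + t ^+ 2 * dotp b b).
Proof.
move=> Fq Ta Tb; rewrite defect_polar; apply: (le_trans (ler_normB _ _)).
have Tab u : supported T (fun j => s * a j + u * b j).
  by move=> j jT; rewrite Ta// Tb// !mulr0 addr0.
apply: (le_trans (lerD (Fq _ (Tab t)) (Fq _ (Tab (- t))))).
by rewrite !dotp_lin; lra.
Qed.

Lemma supported_zero_out T c : supported T (zero_out T c).
Proof. by move=> j /negbTE jT; rewrite /zero_out jT. Qed.

Lemma dotp_zero_out T c : dotp (zero_out T c) (zero_out T c) = coef_norm T c ^+ 2.
Proof.
rewrite /coef_norm sqr_sqrtr; last by apply: sumr_ge0 => j _; exact: sqr_ge0.
rewrite [RHS]big_mkcond; apply: eq_bigr => j _; rewrite /zero_out.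
by case: ifP => _; rewrite ?mul0r// expr2.
Qed.

Lemma inner_restrict_mul F T T' c c' :
  inner (restrict_mul F T c) (restrict_mul F T' c') =
  image_dotp F (zero_out T c) (zero_out T' c').
Proof.
have row T1 c1 i : restrict_mul F T1 c1 i 0 = \sum_j zero_out T1 c1 j * F i j.
  rewrite /restrict_mul summxE big_mkcond; apply: eq_bigr => j _.
  by rewrite /zero_out; case: ifP; rewrite ?mul0r// !mxE.
by apply: eq_bigr => i _; rewrite !row.
Qed.

Lemma enorm_restrict_mul F T c :
  enorm (restrict_mul F T c) ^+ 2 = image_dotp F (zero_out T c) (zero_out T c).
Proof.
rewrite /enorm sqr_sqrtr ?inner_restrict_mul//.
by apply: sumr_ge0 => i _; rewrite -expr2 sqr_ge0.
Qed.

Lemma defect_bounded F :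
  exists2 M, 0 <= M & forall c, `|defect F c c| <= M * dotp c c.
Proof.
exists (\sum_i (\sum_j `|F i j|) ^+ 2 + 1).
  by rewrite addr_ge0// sumr_ge0// => i _; exact: sqr_ge0.
move=> c; pose t := Num.sqrt (dotp c c).
have t2 : t ^+ 2 = dotp c c by rewrite sqr_sqrtr// dotp_ge0.
have ct j : `|c j| <= t.
  rewrite -sqrtr_sqr ler_wsqrtr// /dotp (bigD1 j)//= -expr2 lerDl.
  by apply: sumr_ge0 => j' _; rewrite -expr2 sqr_ge0.
rewrite /defect; apply: (le_trans (ler_normB _ _)); rewrite mulrDl mul1r.
apply: lerD; last by rewrite ger0_norm// dotp_ge0.
rewrite /image_dotp ger0_norm; last first.
  by apply: sumr_ge0 => i _; rewrite -expr2 sqr_ge0.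
rewrite mulr_suml; apply: ler_sum => i _.
rewrite -expr2 -real_normK ?num_real// -t2 -exprMn.
apply: lerXn2r; rewrite ?nnegrE ?mulr_ge0 ?sqrtr_ge0 ?sumr_ge0//.
apply: (le_trans (ler_norm_sum _ _ _)); rewrite mulr_suml; apply: ler_sum => j _.
by rewrite normrM mulrC ler_wpM2l.
Qed.

(** For positive [S] the least such [d] is the restricted isometry constant
    [delta] of order [S]; bounding it also bounds [theta]. *)
Definition near_isometry F (S : nat) (d : R) : Prop :=
  forall T c, (#|T| <= S)%N -> supported T c -> `|defect F c c| <= d * dotp c c.

Lemma near_isometry_delta_bound F S d : near_isometry F S d -> delta_bound F S d.
Proof.
move=> Fd T c cardT; have := Fd T _ cardT (supported_zero_out c).
rewrite /defect -enorm_restrict_mul dotp_zero_out ler_norml => /andP[lo hi].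
by apply/andP; split; lra.
Qed.

(** On disjoint supports the polar form of the defect is the inner product of
    the images.  Polarizing [|c'| c] and [|c| c'], which have the same norm,
    loses nothing. *)
Lemma near_isometry_theta_bound F S S' d :
  near_isometry F (S + S') d -> theta_bound F S S' d.
Proof.
move=> Fd T T' c c' disjTT' cardT cardT'.
rewrite inner_restrict_mul.
set a := zero_out T c; set b := zero_out T' c'.
have ab0 : dotp a b = 0.
  rewrite /dotp big1// => j _; rewrite /a /b /zero_out.
  case: ifPn => [jT|_]; last by rewrite mul0r.
  by rewrite (disjointFr disjTT' jT) mulr0.
have -> : image_dotp F a b = defect F a b by rewrite /defect ab0 subr0.
have suppl : supported (T :|: T')%SET a.
  by move=> j; rewrite inE negb_or => /andP[jT _]; exact: supported_zero_out.
have suppr : supported (T :|: T')%SET b.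
  by move=> j; rewrite inE negb_or => /andP[_ jT]; exact: supported_zero_out.
have cardU : (#|T :|: T'| <= S + S')%N.
  by rewrite (leq_trans _ (leq_add cardT cardT'))// cardsU leq_subr.
have := @defect_polar_le F (T :|: T')%SET d (coef_norm T' c') (coef_norm T c) a b
  (fun e => Fd _ e cardU) suppl suppr.
rewrite !dotp_zero_out.
have al0 : 0 <= coef_norm T c by exact: sqrtr_ge0.
have be0 : 0 <= coef_norm T' c' by exact: sqrtr_ge0.
have [al|aln0] := eqVneq (coef_norm T c) 0.
  rewrite al => _; rewrite mulr0 mul0r.
  rewrite defect0 ?normr0//; apply: dotp0_eq0.
  by rewrite dotp_zero_out al expr0n.
have [be|ben0] := eqVneq (coef_norm T' c') 0.
  rewrite be => _; rewrite mulr0.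
  rewrite defectC defect0 ?normr0//; apply: dotp0_eq0.
  by rewrite dotp_zero_out be expr0n.
have alp : 0 < coef_norm T c by rewrite lt0r aln0.
have bep : 0 < coef_norm T' c' by rewrite lt0r ben0.
move: (coef_norm T c) (coef_norm T' c') alp bep {al0 be0 aln0 ben0} => x y x0 y0.
rewrite normrM ger0_norm; last by rewrite !mulr_ge0// ltW.
move=> H; rewrite -(ler_pM2l (_ : 0 < 4 * (y * x))); last by rewrite !mulr_gt0.
by apply: (le_trans H); rewrite le_eqVlt; apply/orP; left; apply/eqP; ring.
Qed.

(** A unit vector supported on one column; its existence is what makes [0] a
    lower bound of the set of admissible constants. *)
Lemma delta_bound_ge0 F (S : nat) (d : R) : (0 < S)%N -> (0 < m)%N ->
  delta_bound F S d -> 0 <= d.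
Proof.
move=> S0 m0 Fd.
have := Fd [set Ordinal m0]%SET (fun=> 1); rewrite cards1 => /(_ S0).
have -> : coef_norm [set Ordinal m0]%SET (fun=> 1) = 1 :> R.
  by rewrite /coef_norm big_set1 expr1n sqrtr1.
by rewrite expr1n !mulr1 => /andP[lo hi]; lra.
Qed.

Lemma theta_bound_ge0 F (S S' : nat) (d : R) :
  (0 < S)%N -> (0 < S')%N -> (1 < m)%N ->
  theta_bound F S S' d -> 0 <= d.
Proof.
move=> S0 S'0 m1 Fd.
have m0 : (0 < m)%N by exact: ltn_trans m1.
have := Fd [set Ordinal m0]%SET [set Ordinal m1]%SET (fun=> 1) (fun=> 1).
rewrite !cards1 => /(_ _ S0 S'0); rewrite disjoints1 inE => /(_ isT).
have cn j : coef_norm [set j]%SET (fun=> 1) = 1 :> R.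
  by rewrite /coef_norm big_set1 expr1n sqrtr1.
by rewrite !cn !mulr1; apply: le_trans.
Qed.

Lemma delta_le F (S : nat) (d : R) : (0 < S)%N -> (0 < m)%N ->
  delta_bound F S d -> delta F S <= d.
Proof.
by move=> S0 m0 Fd; apply: ge_inf => //; exists 0 => e; exact: delta_bound_ge0.
Qed.

Lemma theta_le F (S S' : nat) (d : R) : (0 < S)%N -> (0 < S')%N -> (1 < m)%N ->
  theta_bound F S S' d -> theta F S S' <= d.
Proof.
by move=> S0 S'0 m1 Fd; apply: ge_inf => //; exists 0 => e; exact: theta_bound_ge0.
Qed.

End isometry_defect.

(** * A net of integer vectors *)

Section net.
Context (R : realType) (p m : nat).
Implicit Types (F : 'M[R]_(p, m)) (T : {set 'I_m}).

(** The integers of absolute value at most [N], in sign and magnitude form so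
    that [None] is the only code of zero: the code counts supports as well. *)
Definition digit (N : nat) := option (bool * 'I_N).

Definition digit_abs N (x : digit N) : nat := if x is Some (_, k) then k.+1 else 0%N.

Definition digit_val N (x : digit N) : R :=
  if x is Some (s, k) then (-1) ^+ s * k.+1%:R else 0.

Definition net (S : nat) : {set {ffun 'I_m -> digit (20 * S)}} :=
  [set f : {ffun 'I_m -> digit (20 * S)} |
    (#|[set j | f j != None]%SET| <= S)%N &&
    (\sum_j digit_abs (f j) <= 20 * S)%N]%SET.

Definition net_vec S (f : {ffun 'I_m -> digit (20 * S)}) : 'I_m -> R :=
  fun j => digit_val (f j).

Definition digit_of (N : nat) (s : bool) (k : nat) : digit N :=
  if k is k'.+1 then omap (fun i => (s, i)) (insub k') else None.

Lemma digit_ofP N s k : (k <= N)%N ->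
  digit_abs (digit_of N s k) = k /\ digit_val (digit_of N s k) = (-1) ^+ s * k%:R.
Proof.
case: k => [|k] kN /=; first by rewrite mulr0.
by case: insubP => [i _ ik|]; rewrite ?kN//= -ik.
Qed.

(** Rounding towards zero on the grid of step [1 / (20 sqrt S)]: no entry grows,
    and the [S] errors are at most one step each, hence a total squared error
    of [1 / 400].  The l1 norm of the rounded vector is at most [20 S] because
    the l1 norm of an [S]-sparse unit vector is at most [sqrt S].  The error
    vector is written as a linear combination to match [defect_lin]. *)
Lemma net_approx S T (u : 'I_m -> R) : (0 < S)%N -> (#|T| <= S)%N ->
  supported T u -> dotp u u <= 1 ->
  exists2 f, f \in net S & exists h : R,
    dotp (fun j => h * net_vec f j) (fun j => h * net_vec f j) <= dotp u u /\
    dotp (fun j => 1 * u j + (- 1) * (h * net_vec f j))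
         (fun j => 1 * u j + (- 1) * (h * net_vec f j)) <= 1 / 400 /\
    supported T (fun j => h * net_vec f j).
Proof.
move=> S0 cardT Tu u1.
have SR0 : 0 < S%:R :> R by rewrite ltr0n.
pose r : R := Num.sqrt S%:R.
have r0 : 0 < r by rewrite sqrtr_gt0.
have r2 : r ^+ 2 = S%:R by rewrite sqr_sqrtr// ltW.
pose k j := Num.truncn (20 * r * `|u j|).
have ru0 j : 0 <= 20 * r * `|u j| by rewrite !mulr_ge0// ltW.
have k_le j : (k j)%:R <= 20 * r * `|u j| by rewrite truncn_le.
have k_gt j : 20 * r * `|u j| < (k j)%:R + 1.
  by rewrite natr1; exact: truncnS_gt.
have kT j : j \notin T -> k j = 0%N.
  by move=> jT; rewrite /k Tu// normr0 mulr0 truncn0.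
(* 20 r |u| <= 10 (r^2 u^2 + 1), summed over T *)
have sumk : (\sum_j k j <= 20 * S)%N.
  rewrite -(ler_nat R) natr_sum natrM.
  have -> : \sum_j (k j)%:R = \sum_(j in T) (k j)%:R :> R.
    rewrite [RHS]big_mkcond; apply: eq_bigr => j _.
    by case: ifPn => // /kT ->.
  apply: (@le_trans _ _ (\sum_(j in T) 10 * (S%:R * u j ^+ 2 + 1))).
    apply: ler_sum => j _; apply: (le_trans (k_le j)).
    have := sqr_ge0 (r * `|u j| - 1).
    rewrite -(real_normK (num_real (u j))) -r2; move: (`|u j|) => y; lra.
  rewrite -mulr_sumr big_split/= -mulr_sumr sumr_const.
  have -> : 20 * S%:R = 10 * (S%:R * 1 + S%:R) :> R by lra.
  rewrite ler_wpM2l// lerD ?ler_nat// ler_wpM2l// (le_trans _ u1)//.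
  rewrite big_mkcond; apply: ler_sum => j _.
  by rewrite -expr2; case: ifP => // _; exact: sqr_ge0.
have k_le20 j : (k j <= 20 * S)%N.
  by apply: leq_trans sumk; rewrite (bigD1 j)//= leq_addr.
pose f := [ffun j => digit_of (20 * S) (u j < 0) (k j)].
exists f.
  rewrite inE; apply/andP; split.
    apply: leq_trans (subset_leq_card _) cardT.
    apply/fintype.subsetP => j; rewrite inE ffunE; apply: contraNT => jT.
    by rewrite kT.
  by under eq_bigr do rewrite ffunE (digit_ofP _ (k_le20 _)).1.
exists (20 * r)^-1.
have r20 : 0 < 20 * r by rewrite mulr_gt0.
have vE j : (20 * r)^-1 * net_vec f j = (-1) ^+ (u j < 0)%R * ((k j)%:R / (20 * r)).
  by rewrite /net_vec ffunE (digit_ofP _ (k_le20 _)).2; ring.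
have kr0 j : 0 <= (k j)%:R / (20 * r) by rewrite divr_ge0// ltW.
have k_ler j : (k j)%:R / (20 * r) <= `|u j| by rewrite ler_pdivrMr// mulrC.
split; [|split].
- apply: ler_sum => j _; rewrite vE -!expr2 exprMn sqrr_sign mul1r.
  rewrite -(real_normK (num_real (u j))) ler_pXn2r ?nnegrE ?kr0 ?normr_ge0//.
- apply: (@le_trans _ _ (\sum_(j in T) (20 * r) ^- 2)).
    rewrite [leRHS]big_mkcond; apply: ler_sum => j _; rewrite vE -expr2.
    case: ifPn => [jT|/[dup]/kT -> /Tu ->]; last first.
      by rewrite mul0r !mulr0 addr0 expr0n.
    rewrite {1}(realEsign (num_real (u j))).
    have -> : 1 * ((-1) ^+ (u j < 0)%R * `|u j|) +
        -1 * ((-1) ^+ (u j < 0)%R * ((k j)%:R / (20 * r))) =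
        (-1) ^+ (u j < 0)%R * (`|u j| - (k j)%:R / (20 * r)) by ring.
    rewrite exprMn sqrr_sign mul1r -exprVn.
    rewrite ler_pXn2r ?nnegrE ?invr_ge0 ?(ltW r20)//; last first.
      by rewrite subr_ge0.
    rewrite lerBlDr -[X in X + _]mul1r -mulrDl ler_pdivlMr// (addrC 1) mulrC.
    exact/ltW/k_gt.
  rewrite sumr_const -[leLHS]mulr_natl exprMn r2.
  rewrite ler_pdivrMr ?mulr_gt0 ?exprn_gt0//.
  by move: cardT; rewrite -(ler_nat R); lra.
- by move=> j jT; rewrite vE (Tu _ jT) kT// mul0r mulr0.
Qed.

(** Let [q] be the supremum of the defect over the unit ball of the vectors
    supported on [T], and [v] the approximation of [u] by a multiple of a net
    vector.  The defects of [u] and [v] differ by the polar form at [u - v] and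
    [u + v], of norms at most [1 / 20] and [2], that is by at most [q / 10].
    Hence [q <= x + q / 10]. *)
Lemma net_near_isometry F (S : nat) (x : R) : 0 <= x ->
  (forall f, f \in net S -> `|defect F (net_vec f) (net_vec f)| <=
      x * dotp (net_vec f) (net_vec f)) ->
  near_isometry F S (x / (9 / 10)).
Proof.
move=> x0 netx T c cardT Tc.
have [S0|] := posnP S.
  have c0 j : c j = 0.
    by apply: Tc; move: cardT; rewrite S0 leqn0 cards_eq0 => /eqP ->; rewrite inE.
  by rewrite defect0// normr0 mulr_ge0// ?divr_ge0// dotp_ge0.
move=> S0.
pose ball := [set y | exists u : 'I_m -> R,
   [/\ supported T u, dotp u u <= 1 & y = `|defect F u u|]].
pose q := sup ball.
have [M M0 FM] := defect_bounded F.
have ball_ub : ubound ball M.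
  move=> _ [u [_ u1 ->]]; apply: (le_trans (FM u)).
  by rewrite ler_piMr.
have ball0 : ball 0.
  exists (fun=> 0); split => //.
    by rewrite /dotp big1// => j _; rewrite mul0r.
  by rewrite defect0// normr0.
have has_sup_ball : has_sup ball by split; [exists 0|exists M].
have q0 : 0 <= q by exact: sup_upper_bound.
have qP u : supported T u -> `|defect F u u| <= q * dotp u u.
  move=> Tu; have [u0|un0] := eqVneq (dotp u u) 0.
    by rewrite u0 mulr0 defect0 ?normr0//; exact: dotp0_eq0.
  have un : 0 < dotp u u by rewrite lt0r un0 dotp_ge0.
  pose t := (Num.sqrt (dotp u u))^-1.
  have t2 : t ^+ 2 = (dotp u u)^-1 by rewrite /t exprVn sqr_sqrtr// ltW.
  have : `|defect F (fun j => t * u j) (fun j => t * u j)| <= q.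
    apply: sup_upper_bound => //; exists (fun j => t * u j); split => //.
      by move=> j jT; rewrite Tu// mulr0.
    by rewrite dotpZ t2 mulVf.
  by rewrite defectZ t2 normrM gtr0_norm ?invr_gt0// mulrC ler_pdivrMr.
suff qx : q <= x + q / 10.
  apply: (le_trans (qP _ Tc)); rewrite ler_wpM2r ?dotp_ge0//; lra.
apply: ge_sup; first by exists 0.
move=> _ [u [Tu u1 ->]].
have [f fS [h [vu [uv Tv]]]] := net_approx S0 cardT Tu u1.
set v := (fun j => h * net_vec f j) in vu uv Tv.
have defv : `|defect F v v| <= x.
  rewrite defectZ normrM ger0_norm ?sqr_ge0//.
  apply: (@le_trans _ _ (h ^+ 2 * (x * dotp (net_vec f : _ -> R) (net_vec f)))).
    by rewrite ler_wpM2l ?sqr_ge0// netx.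
  rewrite mulrCA -dotpZ -[leRHS]mulr1 ler_wpM2l//.
  exact: le_trans u1.
pose a j := 1 * u j + (- 1) * v j.
pose b j := 1 * u j + 1 * v j.
have -> : defect F u u = defect F v v + defect F a b by rewrite defect_lin; ring.
apply: (le_trans (ler_normD _ _)); apply: lerD => //.
have Ta : supported T a by move=> j jT; rewrite /a Tu// Tv// !mulr0 addr0.
have Tb : supported T b by move=> j jT; rewrite /b Tu// Tv// !mulr0 addr0.
have b4 : dotp b b <= 4.
  have := dotp_ge0 a; rewrite /a /b !dotp_lin; lra.
(* the ratio 40 = 2 / (1/20) of the norms of b and a is optimal *)
have := @defect_polar_le _ _ _ F T q 40 1 a b qP Ta Tb.
have -> : 4 * (40 * 1) * defect F a b = 160 * defect F a b by ring.
rewrite normrM ger0_norm// => H.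
have : 160 * `|defect F a b| <= 2 * q * 8.
  apply: (le_trans H); rewrite ler_wpM2l ?mulr_ge0//; lra.
lra.
Qed.

End net.

(** * The size of the net *)

Section net_count.
Context (R : realType).

(** The marks of the generating function: [w] for a nonzero entry, [y] for each
    unit of its absolute value. *)
Definition digit_weight (w y : R) N (x : digit N) : R :=
  (if x is None then 1 else w) * y ^+ digit_abs x.

Lemma sum_digit_weight (w y : R) N : 0 <= w -> 0 <= y < 1 ->
  \sum_(x : digit N) digit_weight w y x <= 1 + 2 * w * (y / (1 - y)).
Proof.
move=> w0 /andP[y0 y1].
rewrite (bigD1 None)//= {1}/digit_weight /= mulr1 lerD2l.
rewrite (reindex_omap Some id)/=; last by case.
under eq_bigl do rewrite eqxx.
rewrite (eq_bigr (fun x => digit_weight w y (Some (x.1, x.2)))); last by case.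
rewrite -(pair_bigA _ (fun (s : bool) (k : 'I_N) => digit_weight w y (Some (s, k)))) /=.
rewrite big_bool/= /digit_weight/= -mulr_sumr.
have geom : \sum_(i < N) y ^+ i.+1 <= y / (1 - y).
  under eq_bigr do rewrite exprS.
  rewrite -mulr_sumr ler_wpM2l// -[_^-1]mul1r ler_pdivlMr ?subr_gt0// mulrC.
  have := subrX1 y N; move: (\sum_(i < N) _) (exprn_ge0 N y0) => s; lra.
by have := ler_wpM2l w0 geom; lra.
Qed.

Lemma digit_ratio_ge : 40 / 107 <= (20 / 21) ^+ 20 :> R.
Proof.
have y5 : 7835 / 10000 <= (20 / 21) ^+ 5 :> R by lra.
rewrite -[(20 / 21) ^+ 20]/((20 / 21) ^+ (5 * 4)) exprM.
apply: (@le_trans _ _ ((7835 / 10000) ^+ 4)); first by lra.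
by apply: lerXn2r y5; rewrite nnegrE; lra.
Qed.

(** Each net vector has weight at least [w^S y^(20 S)], and the total weight of
    all vectors is at most [(1 + 2 w y / (1 - y))^m].  The choice of [w] makes
    this [(1 - q)^(- m)], so that the bound on the number of supports is the
    entropy bound for binomial coefficients; [y = 20 / 21] nearly minimizes the
    cost [2 y^(-19) / (1 - y)] of a nonzero entry, which is then just below
    [107]. *)
Lemma card_net_le (m S : nat) (q : R) : 0 < q <= 1 / 2 -> S%:R <= q * m%:R ->
  #|net m S|%:R <= expR (m%:R * (entropy q + q * ln 107)).
Proof.
move=> /andP[q0 q2] Sqm.
pose y : R := 20 / 21.
pose w : R := q / (40 * (1 - q)).
have q1 : 0 < 1 - q by lra.
have w0 : 0 < w by rewrite divr_gt0// mulr_gt0.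
have w1 : w <= 1 by rewrite ler_pdivrMr ?mulr_gt0//; lra.
have total : \sum_(f : {ffun 'I_m -> digit (20 * S)}) \prod_j digit_weight w y (f j)
    <= (1 - q)^-1 ^+ m.
  rewrite -(bigA_distr_bigA
    (fun (_ : 'I_m) (x : digit (20 * S)) => digit_weight w y x))/=.
  rewrite prodr_const card_ord.
  apply: lerXn2r; rewrite ?nnegrE ?invr_ge0 ?(ltW q1)//.
    apply: sumr_ge0 => x _; rewrite mulr_ge0 ?exprn_ge0//; last by rewrite /y; lra.
    by case: x => // _; exact: ltW.
  have y01 : 0 <= y < 1 by rewrite /y; lra.
  apply: (le_trans (sum_digit_weight _ (ltW w0) y01)).
  rewrite le_eqVlt; apply/orP; left; apply/eqP; rewrite /w /y; field.
  by rewrite gt_eqF//; lra.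
have weight_ge f : f \in net m S ->
    w ^+ S * y ^+ (20 * S) <= \prod_j digit_weight w y (f j).
  rewrite inE => /andP[suppf sumf].
  rewrite /digit_weight big_split/= prodrXr.
  rewrite (eq_bigr (fun j => if f j != None then w else 1)); last first.
    by move=> j _; case: (f j).
  rewrite -big_mkcond prodr_const ler_pM//.
  - by rewrite exprn_ge0// ltW.
  - by rewrite exprn_ge0// /y; lra.
  - rewrite ler_wiXn2l ?(ltW w0)//.
    by apply: leq_trans suppf; apply: eq_leq; apply: eq_card => j; rewrite inE.
  - by rewrite ler_wiXn2l// /y; lra.
have cardw : #|net m S|%:R * (w ^+ S * y ^+ (20 * S)) <= (1 - q)^-1 ^+ m.
  apply: le_trans total; rewrite mulr_natl -sumr_const.
  apply: (@le_trans _ _ (\sum_(f in net m S) \prod_j digit_weight w y (f j))).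
    by apply: ler_sum => f; exact: weight_ge.
  rewrite [leLHS]big_mkcond; apply: ler_sum => f _.
  case: ifP => // _; apply: prodr_ge0 => j _.
  rewrite mulr_ge0 ?exprn_ge0//; last by rewrite /y; lra.
  by case: (f j) => // _; exact: ltW.
have y20 : 40 / 107 <= y ^+ 20 by exact: digit_ratio_ge.
pose A := 107 * (1 - q) / q.
have A0 : 0 < A by rewrite divr_gt0 ?mulr_gt0.
have A1 : 1 <= A by rewrite /A ler_pdivlMr//; lra.
have Aw : 1 <= A * (w * y ^+ 20).
  have -> : A * (w * y ^+ 20) = 107 / 40 * y ^+ 20.
    by rewrite /A /w; field; rewrite !gt_eqF.
  by lra.
have card_le : #|net m S|%:R <= (1 - q)^-1 ^+ m * A ^+ S.
  apply: le_trans (_ : #|net m S|%:R * (w ^+ S * y ^+ (20 * S)) * A ^+ S <= _).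
    rewrite -mulrA ler_peMr// exprM -exprMn -exprMn exprn_ege1// mulrC //.
  by rewrite ler_wpM2r// exprn_ge0// ltW.
apply: (le_trans card_le).
have -> : (1 - q)^-1 ^+ m = expR (- (m%:R * ln (1 - q))).
  by rewrite expRN mulrC expRM_natr lnK ?posrE// exprVn.
have -> : A ^+ S = expR (S%:R * ln A) by rewrite expRM_natl lnK.
rewrite -expRD ler_expR.
have lnA0 : 0 <= ln A by rewrite ln_ge0.
apply: (le_trans (lerD (lexx _) (ler_wpM2r lnA0 Sqm))).
rewrite /A ln_div ?posrE ?mulr_gt0// lnM ?posrE// /entropy; lra.
Qed.

End net_count.

(** * Measurability of the restricted isometry constants *)

Lemma measurable_forall (d : measure_display) (T : measurableType d)
    (U : countType) (F : U -> set T) :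
  (forall u, measurable (F u)) -> measurable [set w | forall u, F u w].
Proof.
move=> mF; rewrite (_ : mkset _ = ~` \bigcup_u ~` F u).
  apply: measurableC; apply: countable_bigcupT_measurable => //.
  by move=> u; exact: measurableC.
rewrite setC_bigcup; apply/seteqP; split => w /= Fw u.
  by rewrite setCK => _; exact: Fw.
by have := Fw u Logic.I; rewrite setCK.
Qed.

Lemma rat_approx (R : realType) (m : nat) (c : 'I_m -> R) :
  exists u : nat -> {ffun 'I_m -> rat},
    forall j, (ratr (u n j) : R) @[n --> \oo] --> c j.
Proof.
have /choice[f fP] : forall nj : nat * 'I_m,
    exists q : rat, ratr q \in `]c nj.2, c nj.2 + harmonic nj.1[.
  by move=> [n j]; apply: rat_in_itvoo; rewrite ltrDl /harmonic invr_gt0.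
exists (fun n => [ffun j => f (n, j)]) => j.
apply: (@squeeze_cvgr _ _ _ _ (cst (c j)) (fun n => c j + harmonic n)).
- near=> n; rewrite ffunE; have := fP (n, j); rewrite in_itv/= => /andP[lo hi].
  by rewrite !ltW.
- exact: cvg_cst.
- rewrite -[X in _ --> X]addr0; apply: cvgD; first exact: cvg_cst.
  exact: cvg_harmonic.
Unshelve. all: end_near. Qed.

Lemma cvg_bigsum (R : realType) (I : Type) (r : seq I)
    (f : I -> nat -> R) (l : I -> R) :
  (forall i, f i n @[n --> \oo] --> l i) ->
  (\sum_(i <- r) f i n) @[n --> \oo] --> \sum_(i <- r) l i.
Proof.
move=> fl; elim: r => [|i r IH].
  rewrite big_nil; under eq_fun do rewrite big_nil.
  exact: cvg_cst.
rewrite big_cons; under eq_fun do rewrite big_cons.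
exact: cvgD.
Qed.

Lemma measurable_forall_real (R : realType) (d : measure_display)
    (T : measurableType d) (U : countType) (m : nat)
    (g : T -> U -> ('I_m -> R) -> ('I_m -> R) -> R) :
  (forall t a b, measurable_fun setT (fun w => g w t a b)) ->
  (forall w t (u v : nat -> 'I_m -> R) a b,
     (forall j, u n j @[n --> \oo] --> a j) -> (forall j, v n j @[n --> \oo] --> b j) ->
     g w t (u n) (v n) @[n --> \oo] --> g w t a b) ->
  measurable [set w | forall t a b, 0 <= g w t a b].
Proof.
move=> mg cg.
pose G (t : U * {ffun 'I_m -> rat} * {ffun 'I_m -> rat}) : set T :=
  [set w | 0 <= g w t.1.1 (fun j => ratr (t.1.2 j)) (fun j => ratr (t.2 j))].
rewrite (_ : mkset _ = [set w | forall t, G t w]).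
  apply: measurable_forall => t.
  rewrite (_ : G t = setT `&` (fun w => g w t.1.1 (fun j => ratr (t.1.2 j))
      (fun j => ratr (t.2 j))) @^-1` `[0, +oo[%classic); first exact: mg.
  by rewrite setTI; apply/seteqP; split => w /=; rewrite in_itv/= andbT.
apply/seteqP; split => w /= Gw; first by move=> t; exact: Gw.
move=> t a b.
have [u ua] := rat_approx a; have [v vb] := rat_approx b.
have gab := cg w t _ _ a b ua vb.
apply: (@ler_cvg_to _ _ _ _ (cst 0) _ 0 _ _ gab); first exact: cvg_cst.
by apply: nearW => n; exact: (Gw (t, u n, v n)).
Qed.

(** The infimum is below [x] exactly when some rational below [x] belongs to the
    set. *)
Lemma measurable_inf_up (R : realType) (d : measure_display) (T : measurableType d)
    (B : T -> set R) :
  (forall w, B w !=set0) -> (forall w, has_lbound (B w)) ->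
  (forall w x y, B w x -> x <= y -> B w y) ->
  (forall x, measurable [set w | B w x]) ->
  measurable_fun setT (fun w => inf (B w)).
Proof.
move=> B0 Blb Bup mB.
apply: (measurability _ (RGenCInfty.measurableE R)) => //.
move=> _ [_ [x ->] <-]; rewrite setTI.
rewrite (_ : _ @^-1` _ = ~` \bigcup_(q : rat) [set w | ratr q < x /\ B w (ratr q)]).
  apply: measurableC; apply: countable_bigcupT_measurable => // q.
  have [qx|qx] := ltP (ratr q) x.
    rewrite (_ : mkset _ = [set w | B w (ratr q)]); first exact: mB.
    by apply/seteqP; split => w /= => [[]|].
  rewrite (_ : mkset _ = set0) //.
  by apply/seteqP; split => w //= [].
apply/seteqP; split => w /=; rewrite in_itv/= andbT.
  move=> xB [q _ /= [qx Bq]].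
  by have := ge_inf (Blb w) Bq; rewrite leNgt (lt_le_trans qx xB).
move=> nB; rewrite leNgt; apply/negP => Bx.
have [y By yx] := inf_lt (B0 w) Bx.
have [q] := rat_in_itvoo yx; rewrite in_itv/= => /andP[yq qx].
by apply: nB; exists q => //; split => //; apply: Bup By _; exact: ltW.
Qed.

Section measurable_constants.
Context (R : realType) (d : measure_display) (Omega : measurableType d).
Context (p m : nat) (F : Omega -> 'M[R]_(p, m)).
Hypothesis mF : forall i j, measurable_fun setT (fun w => F w i j).

Lemma measurable_image_dotp a b : measurable_fun setT (fun w => image_dotp (F w) a b).
Proof.
apply: measurable_sum => i; apply: measurable_funM; apply: measurable_sum => j;
  exact: measurable_funM.
Qed.

Lemma cvg_zero_out T (u : nat -> 'I_m -> R) c :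
  (forall j, u n j @[n --> \oo] --> c j) ->
  forall j, zero_out T (u n) j @[n --> \oo] --> zero_out T c j.
Proof. by move=> uc j; rewrite /zero_out; case: ifP => // _; exact: cvg_cst. Qed.

Lemma cvg_dotp (u v : nat -> 'I_m -> R) a b :
  (forall j, u n j @[n --> \oo] --> a j) -> (forall j, v n j @[n --> \oo] --> b j) ->
  dotp (u n) (v n) @[n --> \oo] --> dotp a b.
Proof. by move=> ua vb; apply: cvg_bigsum => j; exact: cvgM. Qed.

Lemma cvg_image_dotp (G : 'M[R]_(p, m)) (u v : nat -> 'I_m -> R) a b :
  (forall j, u n j @[n --> \oo] --> a j) -> (forall j, v n j @[n --> \oo] --> b j) ->
  image_dotp G (u n) (v n) @[n --> \oo] --> image_dotp G a b.
Proof.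
move=> ua vb; apply: cvg_bigsum => i; apply: cvgM; apply: cvg_bigsum => j;
  by apply: cvgM => //; exact: cvg_cst.
Qed.

Lemma cvg_coef_norm T (u : nat -> 'I_m -> R) a :
  (forall j, u n j @[n --> \oo] --> a j) ->
  coef_norm T (u n) @[n --> \oo] --> coef_norm T a.
Proof.
move=> ua.
have sqE c : coef_norm T c = Num.sqrt (dotp (zero_out T c) (zero_out T c)).
  by rewrite dotp_zero_out sqrtr_sqr ger0_norm// sqrtr_ge0.
rewrite sqE; under eq_fun do rewrite sqE.
apply: continuous_cvg; first exact: sqrt_continuous.
by apply: cvg_dotp; exact: cvg_zero_out.
Qed.

Lemma measurable_delta S : (0 < S)%N -> (0 < m)%N ->
  measurable_fun setT (fun w => delta (F w) S).
Proof.
move=> S0 m0; apply: measurable_inf_up.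
- move=> w; have [M _ FM] := defect_bounded (F w).
  by exists M; apply: near_isometry_delta_bound => T c _ _; exact: FM.
- move=> w; exists 0 => e; exact: delta_bound_ge0.
- move=> w x y Fx xy T c cT; have /andP[lo hi] := Fx T c cT.
  have := ler_wpM2r (sqr_ge0 (coef_norm T c)) xy.
  by move=> ?; apply/andP; split; lra.
- move=> x.
  pose g w (T : {set 'I_m}) (a b : 'I_m -> R) : R :=
    if (#|T| <= S)%N then x * coef_norm T a ^+ 2 -
      `|image_dotp (F w) (zero_out T a) (zero_out T a) - coef_norm T a ^+ 2| else 0.
  rewrite (_ : mkset _ = [set w | forall T a b, 0 <= g w T a b]).
    apply: measurable_forall_real => [T a b|w T u v a b ua _];
      rewrite /g; case: (#|T| <= S)%N.
    + apply: measurable_funB => //; apply: measurableT_comp => //.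
      by apply: measurable_funB => //; exact: measurable_image_dotp.
    + exact: measurable_cst.
    + have ca := cvg_coef_norm (T := T) ua.
      apply: cvgB; first by apply: cvgM; [exact: cvg_cst|exact: cvgM].
      apply: cvg_norm; apply: cvgB; last exact: cvgM.
      by apply: cvg_image_dotp; exact: cvg_zero_out.
    + exact: cvg_cst.
  apply/seteqP; split => w /=.
    move=> Fx T a b; rewrite /g; case: ifP => // cT.
    have /andP[lo hi] := Fx T a cT; move: lo hi.
    rewrite enorm_restrict_mul subr_ge0 ler_norml => lo hi.
    by apply/andP; split; lra.
  move=> gw T c cT; have := gw T c c; rewrite /g cT subr_ge0 ler_norml.
  by rewrite enorm_restrict_mul => /andP[lo hi]; apply/andP; split; lra.
Qed.

Lemma measurable_theta S S' : (0 < S)%N -> (0 < S')%N -> (1 < m)%N ->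
  measurable_fun setT (fun w => theta (F w) S S').
Proof.
move=> S0 S'0 m1; apply: measurable_inf_up.
- move=> w; have [M _ FM] := defect_bounded (F w).
  by exists M; apply: near_isometry_theta_bound => T c _ _; exact: FM.
- move=> w; exists 0 => e; exact: theta_bound_ge0.
- move=> w x y Fx xy T T' c c' dT cT cT'; apply: le_trans (Fx T T' c c' dT cT cT') _.
  by rewrite -!mulrA ler_wpM2r// mulr_ge0// sqrtr_ge0.
- move=> x.
  pose g w (T : {set 'I_m} * {set 'I_m}) (a b : 'I_m -> R) : R :=
    if [&& [disjoint T.1 & T.2]%bool, (#|T.1| <= S)%N & (#|T.2| <= S')%N] then
      x * coef_norm T.1 a * coef_norm T.2 b -
      `|image_dotp (F w) (zero_out T.1 a) (zero_out T.2 b)| else 0.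
  rewrite (_ : mkset _ = [set w | forall T a b, 0 <= g w T a b]).
    apply: measurable_forall_real => [T a b|w T u v a b ua vb];
      rewrite /g; case: [&& _, _ & _].
    + apply: measurable_funB => //; apply: measurableT_comp => //.
      exact: measurable_image_dotp.
    + exact: measurable_cst.
    + have ca := cvg_coef_norm (T := T.1) ua; have cb := cvg_coef_norm (T := T.2) vb.
      apply: cvgB.
        by apply: cvgM => //; apply: cvgM => //; exact: cvg_cst.
      by apply: cvg_norm; apply: cvg_image_dotp; exact: cvg_zero_out.
    + exact: cvg_cst.
  apply/seteqP; split => w /=.
    move=> Fx [T T'] a b; rewrite /g /=; case: ifP => // /and3P[dT cT cT'].
    by have := Fx T T' a b dT cT cT'; rewrite inner_restrict_mul subr_ge0.
  move=> gw T T' a b dT cT cT'; have := gw (T, T') a b.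
  by rewrite /g/= dT cT cT' /= subr_ge0 inner_restrict_mul.
Qed.

End measurable_constants.

(** * Deviation on all sparse vectors *)

(** The union is returned as one measurable set, so that later events need only
    contain its complement. *)
Lemma union_bound (R : realType) (d : measure_display) (Omega : measurableType d)
    (P : probability Omega R) (I : eqType) (s : seq I) (A : I -> set Omega) (e : R) :
  (forall i, i \in s -> measurable (A i)) ->
  (forall i, i \in s -> (P (A i) <= e%:E)%E) ->
  exists B, [/\ measurable B, (P B <= ((size s)%:R * e)%:E)%E &
    forall i w, i \in s -> A i w -> B w].
Proof.
elim: s => [|i s IH] mA PA.
  by exists set0; split => //; rewrite measure0 mul0r.
have [j js|j js|B [mB PB AB]] := IH.
- by apply: mA; rewrite inE js orbT.
- by apply: PA; rewrite inE js orbT.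
have mAi : measurable (A i) by apply: mA; rewrite mem_head.
exists (A i `|` B); split.
- exact: measurableU.
- apply: (le_trans (measureU2 _ mAi mB)).
  rewrite /= -natr1 mulrDl mul1r addrC EFinD.
  by apply: leeD => //; apply: PA; rewrite mem_head.
- move=> j w; rewrite inE => /orP[/eqP ->|js] Aj; first by left.
  by right; exact: AB js Aj.
Qed.

Section whp.
Context (R : realType) (d : measure_display) (Omega : measurableType d).
Context (P : probability Omega R) (p m : nat).
Context (X : 'I_p -> 'I_m -> {RV P >-> R}).
Hypothesis iidX : iid_gaussian_entries X.
Hypothesis p0 : (0 < p)%N.

Lemma near_isometry_whp (S : nat) (q x : R) :
  0 < q <= 1 / 2 -> S%:R <= q * m%:R -> 0 < x -> exists B, [/\ measurable B,
    (P B <= (2 * expR (m%:R * (entropy q + q * ln 107) -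
                       p%:R * (x ^+ 2 / (4 * (1 + x)))))%:E)%E &
    forall w, ~ B w -> near_isometry (random_matrix X w) S (x / (9 / 10))].
Proof.
move=> q01 Sqm x0.
pose Y (ij : 'I_p * 'I_m) := X ij.1 ij.2.
have lawY ij (B : set R) : measurable B ->
    P (Y ij @^-1` B) = normal_prob 0 (Num.sqrt p%:R^-1) B.
  by move=> mB; have := iidX.2 ij.1 ij.2 B mB.
pose z (f : {ffun 'I_m -> digit (20 * S)}) : 'I_m -> R := net_vec R f.
pose N f := \sum_j z f j ^+ 2.
(* the zero vector belongs to the net; its bad event is void *)
pose A f := [set w | 0 < N f /\ x * N f <= `|rows_sqnorm Y (z f) w - N f|].
have A0 f : ~~ (0 < N f) -> A f = set0.
  by move=> /negP N0; apply/seteqP; split => w //= [].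
have A1 f : 0 < N f -> A f = [set w | x * N f <= `|rows_sqnorm Y (z f) w - N f|].
  by move=> N0; apply/seteqP; split => w /= => [[]|].
have [||B [mB PB AB]] := @union_bound _ _ _ P _ (enum (net m S)) A
   (2 * expR (- (p%:R * (x ^+ 2 / (4 * (1 + x)))))).
- move=> f _; have [N0|N0] := boolP (0 < N f); last by rewrite A0.
  rewrite A1//; apply: measurable_superlevel; apply: measurableT_comp => //.
  by apply: measurable_funB => //; exact: measurable_rows_sqnorm.
- move=> f _; have [N0|N0] := boolP (0 < N f); last first.
    by rewrite A0// measure0 lee_fin mulr_ge0 ?expR_ge0.
  by rewrite A1//; apply: rows_sqnorm_tail => //; exact: iidX.1.
exists B; split => //.
  apply: (le_trans PB); rewrite lee_fin mulrCA ler_wpM2l// -cardE expRD.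
  by rewrite ler_wpM2r ?expR_ge0// card_net_le.
move=> w nBw; apply: net_near_isometry; first exact: ltW.
move=> f fS.
have NE : dotp (z f) (z f) = N f by apply: eq_bigr => j _; rewrite expr2.
have rowsE : image_dotp (random_matrix X w) (z f) (z f) = rows_sqnorm Y (z f) w.
  apply: eq_bigr => i _; rewrite -expr2; congr (_ ^+ 2).
  by apply: eq_bigr => j _; rewrite mxE.
have [N0|Nn0] := eqVneq (N f) 0.
  rewrite defect0 ?normr0 ?mulr_ge0 ?(ltW x0) ?dotp_ge0//.
  by apply: dotp0_eq0; rewrite NE.
rewrite /defect -/(z f) rowsE NE leNgt; apply/negP => bad; apply: nBw.
apply: (AB f); first by rewrite mem_enum.
split; last exact: ltW.
by rewrite lt0r Nn0 -NE dotp_ge0.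
Qed.

End whp.

(** The three summands are bounded by the deviations for [S], [2 S] and [3 S].
    Only [S <= q m] enters the count of the net, so one choice of [q] covers all
    smaller [r] with the same constants. *)
Lemma gaussian_whp_of_exponents (R : realType) (kappa : R) (q x : nat -> R) :
  0 < kappa ->
  (forall j, (0 < j < 4)%N -> [/\ 0 < q j <= 1 / 2, 0 < x j &
     entropy (q j) + q j * ln 107 < kappa * (x j ^+ 2 / (4 * (1 + x j)))]) ->
  x 1%N + x 2%N + x 3%N < 9 / 10 ->
  forall r, 0 < r -> (forall j, (0 < j < 4)%N -> j%:R * r <= q j) ->
  gaussian_whp kappa r.
Proof.
move=> kappa0 qx sumx r r0 rq.
pose gap j := kappa * (x j ^+ 2 / (4 * (1 + x j))) - (entropy (q j) + q j * ln 107).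
have gap0 j : (0 < j < 4)%N -> 0 < gap j by move=> /qx[_ _]; rewrite subr_gt0.
pose c := Num.min (gap 1%N) (Num.min (gap 2%N) (gap 3%N)).
have cgap j : (0 < j < 4)%N -> c <= gap j.
  by case: j => [|[|[|[|]]]]// _; rewrite /c !ge_min lexx ?orbT.
exists 6, c; split => //.
  by rewrite !lt_min !gap0.
move=> m p S m0 pE SE d Omega P X iidX.
have mR0 : 0 < m%:R :> R by rewrite ltr0n.
have p0 : (0 < p)%N by rewrite -(ltr_nat R) pE mulr_gt0.
have S0 : (0 < S)%N by rewrite -(ltr_nat R) SE mulr_gt0.
have m1 : (1 < m)%N.
  have [/andP[_ q2] _ _] := qx 1%N isT; have := rq 1%N isT; rewrite mul1r => rq1.
  have : 1 <= r * m%:R by rewrite -SE ler1n.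
  have : r * m%:R <= 1 / 2 * m%:R by rewrite ler_wpM2r ?(ltW mR0)//; lra.
  by move=> ? ?; rewrite -(ltr_nat R); lra.
have whp j : (0 < j < 4)%N -> exists B, [/\ measurable B,
    (P B <= (2 * expR (- c * m%:R))%:E)%E &
    forall w, ~ B w -> near_isometry (random_matrix X w) (j * S) (x j / (9 / 10))].
  move=> j4; have [q01 xj0 _] := qx j j4.
  have Sqm : (j * S)%:R <= q j * m%:R.
    by rewrite natrM SE mulrA ler_wpM2r ?(ltW mR0)// rq.
  have [B [mB PB nB]] := near_isometry_whp iidX p0 q01 Sqm xj0.
  exists B; split => //; apply: (le_trans PB).
  rewrite lee_fin ler_wpM2l// ler_expR pE.
  have := ler_wpM2r (ltW mR0) (cgap j j4); rewrite /gap; lra.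
have [B1 [mB1 PB1 nB1]] := whp 1%N isT.
have [B2 [mB2 PB2 nB2]] := whp 2%N isT.
have [B3 [mB3 PB3 nB3]] := whp 3%N isT.
pose B := B1 `|` B2 `|` B3.
have mB : measurable B by do 2 apply: measurableU => //.
have PB : (P B <= (6 * expR (- c * m%:R))%:E)%E.
  apply: (le_trans (measureU2 _ _ mB3)); first exact: measurableU.
  apply: (@le_trans _ _ (P B1 + P B2 + P B3)%E).
    by rewrite leeD2r//; exact: measureU2.
  apply: (le_trans (leeD (leeD PB1 PB2) PB3)).
  by rewrite -!EFinD lee_fin; lra.
have mX i j : measurable_fun setT (fun w => random_matrix X w i j).
  by under eq_fun do rewrite mxE; exact: measurable_funPT.
set G := [set w | _].
have mG : measurable G.
  pose g w := delta (random_matrix X w) S + theta (random_matrix X w) S S +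
    theta (random_matrix X w) S (2 * S)%N.
  have mg : measurable_fun setT g.
    apply: measurable_funD; first apply: measurable_funD.
    - exact: measurable_delta.
    - exact: measurable_theta.
    - by apply: measurable_theta => //; rewrite muln_gt0.
  rewrite (_ : G = setT `&` g @^-1` `]-oo, 1[%classic); first exact: mg.
  by rewrite setTI; apply/seteqP; split => w /=; rewrite in_itv.
apply: (@le_trans _ _ (P (~` B))).
  rewrite probability_setC// EFinB leeB//.
apply: le_measure; rewrite ?inE//; first exact: measurableC.
move=> w nBw.
have nB1w := nB1 w (fun b => nBw (or_introl (or_introl b))).
have nB2w := nB2 w (fun b => nBw (or_introl (or_intror b))).
have nB3w := nB3 w (fun b => nBw (or_intror b)).
rewrite /G/=.
have dle : delta (random_matrix X w) S <= x 1%N / (9 / 10).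
  by apply: delta_le => //; apply: near_isometry_delta_bound; rewrite -[S]mul1n.
have tle : theta (random_matrix X w) S S <= x 2%N / (9 / 10).
  by apply: theta_le => //; apply: near_isometry_theta_bound; rewrite addnn -mul2n.
have tle2 : theta (random_matrix X w) S (2 * S) <= x 3%N / (9 / 10).
  apply: theta_le; rewrite ?muln_gt0//.
  by apply: near_isometry_theta_bound; rewrite -mulSn.
lra.
Qed.

(** * The exponent condition *)

Section numerics.
Context (R : realType).
Implicit Types (kappa q r : R).

Lemma ln_le_subr1 (t : R) : 0 < t -> ln t <= t - 1.
Proof.
move=> t0; have := @le_ln1Dx R (t - 1).
by rewrite (_ : 1 + (t - 1) = t); [apply; lra|ring].
Qed.

(** The bound [ln t <= (t - 1 / t) / 2] is sharp to third order at [1], so it is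
    applied to the four factors of [2 = 5/4 * 6/5 * 7/6 * 8/7]. *)
Lemma ln2_le : ln 2 <= 7 / 10 :> R.
Proof.
have : ln 2 = ln (5 / 4) + ln (6 / 5) + ln (7 / 6) + ln (8 / 7) :> R.
  rewrite -!lnM ?posrE ?mulr_gt0 ?divr_gt0//.
  by congr ln; field.
have /ln_le_sinh : 1 <= 5 / 4 :> R by lra.
have /ln_le_sinh : 1 <= 6 / 5 :> R by lra.
have /ln_le_sinh : 1 <= 7 / 6 :> R by lra.
have /ln_le_sinh : 1 <= 8 / 7 :> R by lra.
by rewrite !invf_div; lra.
Qed.

(** [107 * (1 + 21 / 107) = 2^7]. *)
Lemma ln107_le : ln 107 <= 473 / 100 :> R.
Proof.
have t0 : 0 < 1 + 21 / 107 :> R by lra.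
have t107 : (0 : R) < 107 by lra.
have E : 107 * (1 + 21 / 107) = 2 ^+ 7 :> R by lra.
have : ln (107 * (1 + 21 / 107)) = ln 107 + ln (1 + 21 / 107) :> R.
  by apply: lnM; rewrite posrE.
rewrite E lnXn; last by lra.
have /ln1D_ge : 0 <= 21 / 107 :> R by lra.
by have := ln2_le; rewrite -mulr_natl; lra.
Qed.

Lemma entropy_ge q : 0 < q < 1 -> q * (- ln q) + q * (1 - q) <= entropy q.
Proof.
move=> /andP[q0 q1]; rewrite /entropy.
have := @ln_le_subr1 (1 - q); rewrite subr_gt0 => /(_ q1) l1.
have q1' : 0 <= 1 - q by lra.
have := ler_wpM2l q1' l1; lra.
Qed.

Lemma entropy_le q : 0 < q < 1 -> entropy q <= q * (- ln q) + q.
Proof.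
move=> /andP[q0 q1]; rewrite /entropy.
have q1' : 0 < 1 - q by lra.
have := @ln_le_subr1 (1 - q)^-1; rewrite invr_gt0 => /(_ q1').
rewrite lnV ?posrE// => l1.
have := ler_wpM2l (ltW q1') l1; rewrite mulrBr mulfV ?gt_eqF//; lra.
Qed.

(** Write [s = sqrt q] and [h = sqrt (2 H q)], so that [sqrt kappa * f = s + h].
    From [D < 1] follows [f < sqrt 2 - 1], hence [s + h < 29 / 70].  With
    [H q >= 2 q (1 - q)] this makes [q] small, then [- ln q >= 3], and finally
    [H q >= 3.9 q] and [h >= 2.79 s].  On the other side
    [x^2 / (4 (1 + x)) >= 0.61 f^2] on the range of [f], and
    [0.61 (s + h)^2] exceeds [h^2 / 2 + 4.73 s^2] once [h >= 2.79 s]. *)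
Lemma f_exponent_gap kappa q : 0 < kappa <= 1 -> 0 < q < 1 ->
  let D := - 1 + (1 + f_ kappa q) ^+ 2 in let x := 9 / 10 * D in D < 1 ->
  [/\ q <= 1 / 2, 0 < x &
    entropy q + q * ln 107 < kappa * (x ^+ 2 / (4 * (1 + x)))].
Proof.
move=> /andP[k0 k1] /andP[q0 q1] D x D1.
have q01 : 0 < q < 1 by rewrite q0.
have Hge := entropy_ge q01.
have lnq : 1 - q <= - ln q by have := ln_le_subr1 q0; lra.
pose s := Num.sqrt q; pose h := Num.sqrt (2 * entropy q); pose k := Num.sqrt kappa.
have s0 : 0 < s by rewrite sqrtr_gt0.
have s2 : s ^+ 2 = q by rewrite sqr_sqrtr// ltW.
have k_gt0 : 0 < k by rewrite sqrtr_gt0.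
have k2 : k ^+ 2 = kappa by rewrite sqr_sqrtr// ltW.
have k_le1 : k <= 1 by rewrite -sqrtr1 ler_wsqrtr.
have qq0 : 0 <= q * (1 - q) by rewrite mulr_ge0; lra.
have Hge2 : 2 * (q * (1 - q)) <= entropy q.
  by have := ler_wpM2l (ltW q0) lnq; lra.
have H0 : 0 <= entropy q by lra.
have h0 : 0 <= h by exact: sqrtr_ge0.
have h2 : h ^+ 2 = 2 * entropy q by rewrite sqr_sqrtr// mulr_ge0.
pose f := f_ kappa q.
have fE : k * f = s + h by rewrite /f /f_ mulrA mulfV ?mul1r// gt_eqF.
have f0 : 0 < f by rewrite -(pmulr_rgt0 _ k_gt0) fE; lra.
have DE : D = 2 * f + f ^+ 2 by rewrite /D -/f; ring.
have fub : f < 29 / 70.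
  rewrite ltNge; apply/negP => f1.
  by have := ler_wpM2r (ltW f0) f1; rewrite -expr2; lra.
have shub : s + h < 29 / 70.
  rewrite -fE; apply: le_lt_trans fub; rewrite ler_piMl// ltW//.
have sub1 : s < 29 / 70 by lra.
have q_lt a : 0 <= a -> s <= a -> q <= a ^+ 2.
  by move=> a0 sa; rewrite -s2; apply: lerXn2r => //; rewrite nnegrE ltW.
have h_ge a b : 0 <= a -> a ^+ 2 <= b -> b * q <= h ^+ 2 -> a * s <= h.
  move=> a0 ab bq; rewrite -(@ler_pXn2r _ 2)// ?nnegrE ?mulr_ge0 ?(ltW s0)//.
  by rewrite exprMn s2 (le_trans _ bq)// ler_wpM2r// ltW.
have q18 : q <= 18 / 100.
  have a0 : 0 <= 42 / 100 :> R by lra.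
  have sa : s <= 42 / 100 by lra.
  by have := q_lt _ a0 sa; lra.
have h1 : 18 / 10 * s <= h.
  apply: (h_ge _ (328 / 100)); rewrite ?h2; try lra.
  have := ler_wpM2l (ltW q0) q18; lra.
have q03 : q <= 3 / 100.
  have a0 : 0 <= 15 / 100 :> R by lra.
  have sa : s <= 15 / 100 by lra.
  by have := q_lt _ a0 sa; lra.
have ln3 : 3 <= - ln q.
  rewrite -lnV ?posrE// -[leLHS]expRK ler_ln ?posrE ?expR_gt0 ?invr_gt0//.
  rewrite -[expR 3]invrK lef_pV2 ?posrE ?invr_gt0 ?expR_gt0// -expRN.
  apply: (le_trans q03).
  have -> : - 3 = 12%:R * (- (1 / 4)) :> R by lra.
  rewrite expRM_natl; apply: (@le_trans _ _ ((3 / 4) ^+ 12)); first by lra.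
  apply: lerXn2r; rewrite ?nnegrE ?expR_ge0//; try lra.
  by have := expR_ge1Dx (- (1 / 4) : R); lra.
have H39 : 39 / 10 * q <= entropy q.
  have := ler_wpM2l (ltW q0) ln3; have := ler_wpM2l (ltW q0) q03; lra.
have h3 : 279 / 100 * s <= h by apply: (h_ge _ (78 / 10)); rewrite ?h2; lra.
have f20 : 0 < f ^+ 2 by rewrite exprn_gt0.
have x0 : 0 < x by rewrite /x DE; lra.
split => //; first by lra.
have gam : 61 / 100 * f ^+ 2 <= x ^+ 2 / (4 * (1 + x)).
  rewrite ler_pdivlMr; last by lra.
  rewrite /x DE.
  have -> : (9 / 10 * (2 * f + f ^+ 2)) ^+ 2 =
      f ^+ 2 * (81 / 100 * (2 + f) ^+ 2) by field.
  rewrite mulrAC mulrC ler_wpM2l ?sqr_ge0//.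
  have : f * f <= f * (29 / 70) by rewrite ler_wpM2l// ltW.
  by rewrite -expr2; lra.
apply: lt_le_trans (ler_wpM2l (ltW k0) gam).
have -> : kappa * (61 / 100 * f ^+ 2) = 61 / 100 * (s + h) ^+ 2.
  by rewrite -fE -k2; ring.
have lq : q * ln 107 <= q * (473 / 100) by rewrite ler_wpM2l ?(ltW q0)// ln107_le.
have sh : s * (279 / 100 * s) <= s * h by rewrite ler_wpM2l// ltW.
have HE : entropy q = h ^+ 2 / 2 by lra.
have -> : (s + h) ^+ 2 = q + 2 * (s * h) + h ^+ 2 by rewrite -s2; ring.
have : q * (279 / 100) <= s * h by rewrite -s2; lra.
have : 78 / 10 * q <= h ^+ 2 by lra.
lra.
Qed.

End numerics.

(** * The threshold and the three explicit ranges *)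

Lemma f_ge0 (R : realType) (kappa q : R) : 0 <= f_ kappa q.
Proof. by rewrite mulr_ge0 ?invr_ge0 ?addr_ge0 ?sqrtr_ge0. Qed.

Lemma gaussian_whp_below_threshold (R : realType) (kappa r : R) :
  0 < kappa <= 1 -> 0 < r < rstar kappa -> gaussian_whp kappa r.
Proof.
move=> k01 /andP[r0 rs].
have [s [/andP[_ s3] rho_s] rls] : exists2 s,
    (0 < s < 1 / 3) /\ (forall r', 0 < r' < s -> rho kappa r' < 1) & r < s.
  move: rs; rewrite /rstar; set E := mkset _ => rs.
  have [E0|/set0P E0] := eqVneq E set0.
    by move: rs; rewrite E0 sup0 => rs; lra.
  by have [s Es rls] := sup_gt E0 rs; exists s.
have rho1 : rho kappa r < 1 by apply: rho_s; rewrite r0.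
pose D j : R := - 1 + (1 + f_ kappa (j%:R * r)) ^+ 2.
have D0 j : 0 <= D j.
  have := f_ge0 kappa (j%:R * r); have := sqr_ge0 (f_ kappa (j%:R * r)).
  by rewrite /D; lra.
have rhoE : rho kappa r = D 1%N + D 2%N + D 3%N.
  by rewrite /rho big_ltn// big_ltn// big_ltn// big_geq// addr0 addrA.
have D1 j : (0 < j < 4)%N -> D j < 1.
  have := D0 1%N; have := D0 2%N; have := D0 3%N.
  by case: j => [|[|[|[|]]]]// a b c _; move: rho1; rewrite rhoE; lra.
have jr j : (0 < j < 4)%N -> 0 < j%:R * r < 1.
  by case: j => [|[|[|[|]]]]// _; apply/andP; split; lra.
apply: (@gaussian_whp_of_exponents _ _ (fun j => j%:R * r)
  (fun j => 9 / 10 * D j)) => //.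
- by case/andP: k01.
- move=> j j4; have [q2 x0 gap] := f_exponent_gap k01 (jr j j4) (D1 j j4).
  by split => //; case/andP: (jr j j4) => -> _.
- by move: rho1; rewrite rhoE; lra.
Qed.

(** From [1 / q <= 2^n t]: only the leftover factor [t] is bounded crudely. *)
Lemma oppr_ln_le (R : realType) (n : nat) (t q : R) : 0 < q -> 0 < t ->
  1 <= q * 2 ^+ n * t -> - ln q <= n%:R * (7 / 10) + (t - 1).
Proof.
move=> q0 t0 qnt; have n0 : 0 < 2 ^+ n :> R by rewrite exprn_gt0.
have := ln_ge0 qnt; rewrite !lnM ?posrE ?mulr_gt0// lnXn// -[ln 2 *+ n]mulr_natl.
have := ln_le_subr1 t0; have := ler_wpM2l (ler0n R n) (ln2_le R); lra.
Qed.

Lemma exponent_gap_of_ln (R : realType) (kappa q c L x : R) :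
  0 < kappa -> 0 < q < 1 -> q <= c * kappa -> - ln q <= L -> 0 <= L -> 0 < x ->
  c * (L + 573 / 100) * (4 * (1 + x)) < x ^+ 2 ->
  entropy q + q * ln 107 < kappa * (x ^+ 2 / (4 * (1 + x))).
Proof.
move=> k0 q01 qc lnq L0 x0 cLx; have /andP[q0 q1] := q01.
have x4 : 0 < 4 * (1 + x) by lra.
have := entropy_le q01; have := ler_wpM2l (ltW q0) (ln107_le R).
have := ler_wpM2l (ltW q0) lnq => qL q107 qH.
apply: (@le_lt_trans _ _ (q * (L + 573 / 100))); first by lra.
have L1 : 0 <= L + 573 / 100 by lra.
apply: le_lt_trans (ler_wpM2r L1 qc) _.
by rewrite mulrAC mulrC ltr_pM2l// ltr_pdivlMr.
Qed.

(** The upper end [r0] of each explicit range is at most [4.8 10^(-4) kappa],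
    so that [kappa] cancels from the exponent condition, and at least
    [2.3 10^(-4)], which bounds the logarithm in the entropy. *)
Lemma gaussian_whp_small (R : realType) (kappa r0 : R) :
  0 < kappa <= 1 -> 23 / 10 ^+ 5 <= r0 <= 48 / 10 ^+ 5 * kappa ->
  forall r, 0 < r <= r0 -> gaussian_whp kappa r.
Proof.
move=> /andP[k0 k1] /andP[rlo rk] r /andP[r_gt0 rr0].
have r0_gt0 : 0 < r0 by lra.
have r0_le : r0 <= 1 / 1000 by lra.
apply: (@gaussian_whp_of_exponents _ _ (fun j => j%:R * r0)
  (fun j => nth 0 [:: 0; 1 / 5; 7 / 25; 7 / 20] j)) => //=.
- move=> j j4.
  have jr0 : 0 < j%:R * r0 < 1 /\ j%:R * r0 <= 1 / 2.
    by case: j j4 => [|[|[|[|]]]]// _; split; try (apply/andP; split); lra.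
  case: jr0 => j01 j2; split; first by case/andP: j01 => -> _.
    by case: j j4 {j01 j2} => [|[|[|[|]]]]// _ /=; lra.
  case: j j4 j01 {j2} => [|[|[|[|]]]]// _ j01 /=.
  + apply: (@exponent_gap_of_ln _ _ _ (48 / 10 ^+ 5) (85 / 10)) => //; try lra.
    by apply: (le_trans (@oppr_ln_le R 12 (107 / 100) _ _ _ _)); lra.
  + apply: (@exponent_gap_of_ln _ _ _ (96 / 10 ^+ 5) 8) => //; try lra.
    by apply: (le_trans (@oppr_ln_le R 11 (107 / 100) _ _ _ _)); lra.
  + apply: (@exponent_gap_of_ln _ _ _ (144 / 10 ^+ 5) (75 / 10)) => //; try lra.
    by apply: (le_trans (@oppr_ln_le R 10 (3 / 2) _ _ _ _)); lra.
- by lra.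
- by move=> j _; rewrite ler_wpM2l.
Qed.

Theorem theorem1p6 (R : realType) :
  (forall kappa r : R, 0 < kappa <= 1 -> 0 < r < rstar kappa ->
     gaussian_whp kappa r) /\
  [/\ forall r : R, 0 < r <= 36 / 10 ^+ 5 -> gaussian_whp (3 / 4) r,
      forall r : R, 0 < r <= 32 / 10 ^+ 5 -> gaussian_whp (2 / 3) r &
      forall r : R, 0 < r <= 23 / 10 ^+ 5 -> gaussian_whp (1 / 2) r].
Proof.
split; first exact: gaussian_whp_below_threshold.
by split; apply: gaussian_whp_small; apply/andP; split; lra.
Qed.
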